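(* Let $V$ be a finite dimensional normed vector space over $\mathbb{R}$ or $\mathbb{C}$ and let $\mathbf{X},\mathbf{Y}$ be given rough paths over $V$. Then $\log S(\mathbf{X})$ has infinite radius of convergence if and only if $\log S(\mathbf{Y}\sqcup\mathbf{X}\sqcup\overleftarrow{\mathbf{Y}})$ has infinite radius of convergence.
   Context: $T((V))=\prod_{n\geqslant 0}V^{\otimes n}$ is the algebra of formal tensor series with product $(\xi\otimes\eta)_n=\sum_{k=0}^n\xi_k\otimes\eta_{n-k}$. For $\xi\in T((V))$ with $\xi_0=1$, $\log\xi=\sum_{n\geqslant1}\frac{(-1)^{n-1}}{n}(\xi-\mathbf{1})^{\otimes n}$. Each $V^{\otimes n}$ carries the projective tensor norm $\|\xi\|=\inf\{\sum_j|v_1^j|\cdots|v_n^j|:\ \xi=\sum_j v_1^j\otimes\cdots\otimes v_n^j\}$. A $p$-rough path ($p\geqslant1$) is a continuous map $\mathbf{X}=(1,X^1,\dots,X^{[p]}):\{0\leqslant s\leqslant t\leqslant T\}\to T^{([p])}(V)$ (tensor algebra truncated at level $[p]$) with $\mathbf{X}_{s,u}=\mathbf{X}_{s,t}\otimes\mathbf{X}_{t,u}$ for $s\leqslant t\leqslant u$ and $\sum_{i=1}^{[p]}\sup_{\mathcal P}\sum_{t_l\in\mathcal P}\|X^i_{t_{l-1},t_l}\|^{p/i}<\infty$ (suprema over finite partitions of $[0,T]$). A rough path is a $p$-rough path for some $p\geqslant 1$. By Lyons' extension theorem $\mathbf{X}$ extends uniquely to a multiplicative functional $S(\mathbf{X})_{\cdot,\cdot}$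 with values in $T((V))$ all of whose truncations have finite $p$-variation; $S(\mathbf{X})\triangleq S(\mathbf{X})_{0,T}$ is the signature and $\log S(\mathbf{X})$ the logarithmic signature. $\sqcup$ denotes concatenation and $\overleftarrow{\mathbf{Y}}$ the time reversal of $\mathbf{Y}$, so that $S(\mathbf{Y}\sqcup\mathbf{X})=S(\mathbf{Y})\otimes S(\mathbf{X})$ and $S(\overleftarrow{\mathbf{Y}})=S(\mathbf{Y})^{-1}$. The radius of convergence of $\xi=(\xi_0,\xi_1,\dots)\in T((V))$ is the radius of convergence of the real power series $\sum_{n\geqslant0}\|\xi_n\|z^n$. *)

(* Defs.v *)
From HB Require Import structures.
From mathcomp Require Import all_boot all_order all_algebra.
From mathcomp Require Import complex.
From mathcomp Require Import all_classical all_reals all_analysis.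

Set Implicit Arguments.
Unset Strict Implicit.
Unset Printing Implicit Defensive.

Import Order.TTheory GRing.Theory Num.Theory.
Import numFieldNormedType.Exports.

Local Open Scope classical_set_scope.
Local Open Scope ring_scope.

#[short(type="finNormedModType")]
HB.structure Definition FinNormedModule (K : numFieldType) :=
  {V of NormedModule K V & Vector K V}.

Inductive scalar_kind := real_scalars | complex_scalars.

Definition scalars (R : realType) (k : scalar_kind) : numFieldType :=
  match k with real_scalars => R | complex_scalars => R[i] end.

(* The norm of a [normedModType K] takes its values in [K]; for [K = R[i]] these
   values are nonnegative reals embedded in [R[i]], read back in [R] by [complex.Re]. *)
Definition real_part (R : realType) (k : scalar_kind) : scalars R k -> R :=
  match k return scalars R k -> R with
  | real_scalars => fun x : R => x
  | complex_scalars => fun x : R[i] => complex.Re x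
  end.

Section Tensors.
Context {R : realType} {k : scalar_kind} (V : finNormedModType (scalars R k)).
Local Notation K := (scalars R k).

Definition vnorm (v : V) : R := real_part `|v|.

(* The n-th tensor power of V, in the coordinates of the basis [vbasis {:V}]:
   the entry of a tensor at [w] is its coefficient on the basis tensor
   e_(w_0) (x) ... (x) e_(w_(n-1)). *)
Definition tensor (n : nat) := {ffun n.-tuple 'I_(\dim {:V}) -> K^o}.

Definition pure_tensor n (v : 'I_n -> V) : tensor n :=
  [ffun w : n.-tuple _ => \prod_(i < n) coord (vbasis {:V}) (tnth w i) (v i)].

Definition tensor_prod m n (a : tensor m) (b : tensor n) : tensor (m + n) :=
  [ffun w : (m + n).-tuple _ =>
    a [tuple tnth w (lshift n i) | i < m] * b [tuple tnth w (rshift m i) | i < n]].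

(* On the zeroth power, i.e. on the scalars, the norm is the modulus: empty
   products of vectors only yield the natural numbers there. *)
Definition projective_norm n : tensor n -> R :=
  match n with
  | 0 => fun xi => real_part `|xi [tuple]|
  | m.+1 => fun xi =>
      inf [set r | exists (J : nat) (v : 'I_J -> 'I_m.+1 -> V),
             xi = \sum_(j < J) pure_tensor (v j) /\
             r = \sum_(j < J) \prod_(i < m.+1) vnorm (v j i)]
  end.

Definition tseries := forall n : nat, tensor n.

Implicit Types xi eta : tseries.

Definition tone : tseries := fun n => [ffun=> (n == 0)%:R].

Definition tsub xi eta : tseries := fun n => xi n - eta n.

Definition tmul xi eta : tseries := fun n =>
  \sum_(j < n.+1)
    ecast m (tensor m) (subnKC (leq_ord j)) (tensor_prod (xi j) (eta (n - j)%N)).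

Definition texp xi m : tseries := iter m (tmul xi) tone.

Definition ttrunc N xi : tseries := fun n => if (n <= N)%N then xi n else 0.

(* If xi_0 = 1, then (xi - 1)^m has no component of degree n < m, so that the
   component of degree n of the two series below stops at m = n. *)
Definition tlog xi : tseries := fun n =>
  \sum_(1 <= m < n.+1) ((-1) ^+ m.-1 / m%:R : K) *: texp (tsub xi tone) m n.

Definition tinv xi : tseries := fun n =>
  \sum_(0 <= m < n.+1) texp (tsub tone xi) m n.

Definition radius_of_convergence xi : \bar R :=
  ereal_sup [set z%:E | z in [set z : R | 0 <= z /\
    cvgn (pseries (fun n => projective_norm (xi n)) z)]].

Definition infinite_radius xi := radius_of_convergence xi = +oo%E.

End Tensors.

Section RoughPaths.
Context {R : realType} {k : scalar_kind} (V : finNormedModType (scalars R k)).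
Local Notation series_map := (R -> R -> tseries V).

Definition simplex (T : R) : set (R * R) :=
  [set st | [/\ 0 <= st.1, st.1 <= st.2 & st.2 <= T]].

Definition level_variation (T p : R) (X : series_map) (i : nat) : \bar R :=
  ereal_sup [set (\sum_(0 <= l < size s)
      projective_norm (X (nth T (0 :: s) l) (nth T (0 :: s) l.+1) i)
        `^ (p / i%:R))%:E | s in itv_partition 0 T].

(* The truncation of X at degree N is a continuous multiplicative functional on
   the simplex, with finite p-variation. *)
Record multiplicative_functional (T p : R) (N : nat) (X : series_map) : Prop := {
  mf_one : forall s t, simplex T (s, t) -> X s t 0 = tone V 0;
  mf_continuous : forall n s t, (n <= N)%N -> simplex T (s, t) ->
    projective_norm (X x.1 x.2 n - X s t n)
      @[x --> within (simplex T) (nbhs (s, t))] --> (0 : R);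
  mf_multiplicative : forall n s t u, (n <= N)%N ->
    0 <= s -> s <= t -> t <= u -> u <= T ->
    X s u n = tmul (X s t) (X t u) n;
  mf_variation : (\sum_(1 <= i < N.+1) level_variation T p X i < +oo)%E
}.

(* Elements of the tensor algebra truncated at degree N are encoded as series
   vanishing in all degrees above N. Values off the simplex are irrelevant. *)
Record path_data := PathData {
  exponent : R;
  horizon : R;
  increment : series_map
}.

Implicit Types X Y : path_data.

Definition degree X : nat := Num.truncn (exponent X).

Record rough_path X : Prop := {
  rp_exponent : 1 <= exponent X;
  rp_horizon : 0 <= horizon X;
  rp_functional :
    multiplicative_functional (horizon X) (exponent X) (degree X) (increment X);
  rp_truncated : forall n s t, (degree X < n)%N -> simplex (horizon X) (s, t) ->
    increment X s t n = 0
}.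

Definition is_lyons_extension X (S : series_map) : Prop :=
  (forall n s t, (n <= degree X)%N -> simplex (horizon X) (s, t) ->
     S s t n = increment X s t n) /\
  forall N, multiplicative_functional (horizon X) (exponent X) N S.

(* For a rough path, the extension exists and is unique on the simplex. *)
Definition lyons_extension X : series_map :=
  xget (fun _ _ => tone V) [set S | is_lyons_extension X S].

Definition signature X : tseries V := lyons_extension X 0 (horizon X).

(* First Y, then X. If the exponents differ, both paths are seen as rough paths
   for the larger one, the missing degrees being those of the Lyons extension;
   in degrees already present, the extension is the path itself. *)
Definition concat Y X : path_data :=
  let p := Num.max (exponent Y) (exponent X) in
  let T := horizon Y in
  PathData p (T + horizon X) (fun s t => ttrunc (Num.truncn p)
    (if t <= T then lyons_extension Y s t
     else if s <= T then
       tmul (lyons_extension Y s T) (lyons_extension X 0 (t - T))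
     else lyons_extension X (s - T) (t - T))).

Definition reversal Y : path_data :=
  PathData (exponent Y) (horizon Y) (fun s t => ttrunc (degree Y)
    (tinv (increment Y (horizon Y - t) (horizon Y - s)))).

End RoughPaths.

(* Main.v *)
(** The signature of [Y ⊔ X ⊔ Y^-1] is [g x g^-1] with [g = S(Y)] and [x = S(X)], and
    [log (g x g^-1) = g (log x) g^-1].  Series of infinite radius of convergence form a
    subalgebra, because the projective norms are submultiplicative, so it suffices that
    [g] and [g^-1 = S(Y^-1)] have infinite radius.

    This decay is obtained from a superadditive control [w] with
    [‖S_(s,t)^n‖^(p/n) <= w(s,t)] in low degrees.  By continuity of the path every
    interval splits at a point that halves the control, and for [n > p] the contraction
    [2 * 2^(-n/p) < 1] bounds [S^n] by induction on [n], with constants growing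
    geometrically; cutting [0, T] into pieces of small control makes the radius
    arbitrarily large.  The same contraction gives the uniqueness of the Lyons extension,
    hence [S(Y ⊔ X) = S(Y) S(X)] and [S(Y^-1) = S(Y)^-1].  Existence of the extension is
    never used. *)

Require Import Defs.
From HB Require Import structures.
From mathcomp Require Import all_boot all_order all_algebra.
From mathcomp Require Import complex ring lra zify.
From mathcomp Require Import all_classical all_reals all_analysis.

Set Implicit Arguments.
Unset Strict Implicit.
Unset Printing Implicit Defensive.

Import Order.TTheory GRing.Theory Num.Theory.
Import numFieldNormedType.Exports.

Local Open Scope classical_set_scope.
Local Open Scope ring_scope.

(** * Controls *)

Section Control.
Context {R : realType}.
Implicit Types (F w D : R -> R -> R) (a b c s t u m T : R) (p : seq R).

(** Infinite radius is not inherited by inverses: for a nonzero vector v, [1 - v] has it, while 1 +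
    v + v^2 + ... does not. Hence [S(Y)^-1] must be estimated as the signature of a path of its own,
    and reversal, gluing and change of exponent are set up as operations on families of finite
    variation. Two demands shape the decay estimate. The halving argument presupposes some bound of
    degree n by a power of the very control in use, whereas the control that measures smallness sees
    only low degrees. For each n, a small multiple of the variation of all degrees up to n is
    therefore added to it; the constant of the presupposed bound, however large, is contracted away,
    so the final constants do not depend on n. Moreover the bound has to survive the convolution in
    the product formula. This fixes its shape c * b^n / n^2 * w^(n/p), because the sequence 1/n^2 is
    stable under convolution up to the factor 8. The decay obtained is geometric and not factorial,
    but its ratio b * w^(1/p) tends to 0 with w. *)

Fixpoint psum F a p : R := if p is b :: p' then F a b + psum F b p' else 0.

Lemma psumE F x0 a p :
  \sum_(0 <= l < size p) F (nth x0 (a :: p) l) (nth x0 (a :: p) l.+1) = psum F a p.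
Proof.
elim: p a => [|b p IH] a; first by rewrite big_geq.
by rewrite big_nat_recl //= -IH.
Qed.

Lemma psum_cat F a p q : psum F a (p ++ q) = psum F a p + psum F (last a p) q.
Proof. by elim: p a => [|b p IH] a /=; rewrite ?add0r // IH addrA. Qed.

Lemma psum_ge0 F a p : (forall s t, 0 <= F s t) -> 0 <= psum F a p.
Proof. by move=> F0; elim: p a => //= b p IH a; rewrite addr_ge0. Qed.

Lemma psumD F G a p : psum (fun s t => F s t + G s t) a p = psum F a p + psum G a p.
Proof. by elim: p a => [|b p IH] a /=; rewrite ?addr0 // IH addrACA. Qed.

Lemma psumZ F c a p : psum (fun s t => c * F s t) a p = c * psum F a p.
Proof. by elim: p a => [|b p IH] a /=; rewrite ?mulr0 // IH mulrDr. Qed.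

(** The continuity usually built into a control is replaced by the separate property [halving]. *)
Definition control T w : Prop :=
  (forall s t, 0 <= s -> s <= t -> t <= T -> 0 <= w s t) /\
  (forall s t u, 0 <= s -> s <= t -> t <= u -> u <= T -> w s t + w t u <= w s u).

Definition halving T w : Prop := forall s t, 0 <= s -> s <= t -> t <= T ->
  exists m, [/\ s <= m, m <= t, w s m <= w s t / 2 & w m t <= w s t / 2].

Lemma control_le T w s t a b : control T w ->
  0 <= s -> s <= a -> a <= b -> b <= t -> t <= T -> w a b <= w s t.
Proof.
move=> [w0 wD] s0 sa ab bt tT.
have h1 : w s a + w a b <= w s b by apply: wD => //; apply: le_trans tT.
have h2 : w s b + w b t <= w s t by apply: wD => //; apply: le_trans ab.
have h3 : 0 <= w s a by apply: w0 => //; apply: le_trans ab _; apply: le_trans tT.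
have h4 : 0 <= w b t by apply: w0 => //; apply: le_trans ab; apply: le_trans sa.
lra.
Qed.

Lemma controlD T w w' : control T w -> control T w' -> control T (fun s t => w s t + w' s t).
Proof.
move=> [w0 wD] [w'0 w'D]; split=> [s t s0 st tT|s t u s0 st tu uT].
  by rewrite addr_ge0 ?w0 ?w'0.
by have := wD _ _ _ s0 st tu uT; have := w'D _ _ _ s0 st tu uT; lra.
Qed.

Lemma controlZ T w c : 0 <= c -> control T w -> control T (fun s t => c * w s t).
Proof.
move=> c0 [w0 wD]; split=> [s t s0 st tT|s t u s0 st tu uT].
  by rewrite mulr_ge0 ?w0.
by rewrite -mulrDr ler_wpM2l // wD.
Qed.

Lemma psum_control T F w p a b : control T w -> 0 <= a -> b <= T ->
  (forall s t, 0 <= s -> s < t -> t <= T -> F s t <= w s t) ->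
  itv_partition a b p -> psum F a p <= w a b.
Proof.
move=> cw + bT Fw; elim: p a => [|c p IH] a a0 [].
  by move=> _ /eqP ab; rewrite -{}ab /= in bT *; rewrite cw.1.
move=> /= /andP[ac cp] lb.
have pcb : itv_partition c b p by split.
have cb := itv_partition_le pcb.
have c0 : 0 <= c by apply: le_trans (ltW ac).
have h : psum F c p <= w c b by apply: IH.
have h1 : F a c <= w a c by apply: Fw => //; apply: le_trans bT.
by apply: le_trans (lerD h1 h) _; apply: cw.2 => //; apply: ltW.
Qed.

(** Lower semicontinuity when one endpoint is approached from inside the interval: these are the two
    limits that occur at the cut point in [pvar_halving]. *)
Definition endpoint_lsc T F : Prop :=
  (forall s t (e : R), 0 <= s -> s < t -> t <= T -> 0 < e ->
    exists2 d : R, 0 < d & forall u, s < u -> u < t -> t - u < d -> F s t <= F s u + e) /\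
  (forall s t (e : R), 0 <= s -> s < t -> t <= T -> 0 < e ->
    exists2 d : R, 0 < d & forall u, s < u -> u < t -> u - s < d -> F s t <= F u t + e).

Lemma endpoint_lscD T F G : endpoint_lsc T F -> endpoint_lsc T G ->
  endpoint_lsc T (fun s t => F s t + G s t).
Proof.
move=> [Fl Fr] [Gl Gr]; split=> s t e s0 st tT e0; have e2 : 0 < e / 2 by rewrite divr_gt0.
  have [d d0 hd] := Fl s t _ s0 st tT e2; have [d' d'0 hd'] := Gl s t _ s0 st tT e2.
  exists (Num.min d d') => [|u su ut]; rewrite lt_min ?d0 // => /andP[ud ud'].
  by have := hd u su ut ud; have := hd' u su ut ud'; lra.
have [d d0 hd] := Fr s t _ s0 st tT e2; have [d' d'0 hd'] := Gr s t _ s0 st tT e2.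
exists (Num.min d d') => [|u su ut]; rewrite lt_min ?d0 // => /andP[ud ud'].
by have := hd u su ut ud; have := hd' u su ut ud'; lra.
Qed.

Lemma endpoint_lscZ T F c : 0 < c -> endpoint_lsc T F -> endpoint_lsc T (fun s t => c * F s t).
Proof.
move=> c0 [Fl Fr]; split=> s t e s0 st tT e0; have ec : 0 < e / c by rewrite divr_gt0.
  have [d d0 hd] := Fl s t _ s0 st tT ec; exists d => // u su ut ud.
  by have := ler_wpM2l (ltW c0) (hd u su ut ud); rewrite mulrDr mulrCA divff ?gt_eqF // mulr1.
have [d d0 hd] := Fr s t _ s0 st tT ec; exists d => // u su ut ud.
by have := ler_wpM2l (ltW c0) (hd u su ut ud); rewrite mulrDr mulrCA divff ?gt_eqF // mulr1.
Qed.

Lemma endpoint_lsc_sum T I (r : seq I) (F : I -> R -> R -> R) :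
  (forall i, endpoint_lsc T (F i)) -> endpoint_lsc T (fun s t => \sum_(i <- r) F i s t).
Proof.
move=> h; elim: r => [|i r IH].
  split=> s t e s0 st tT e0; exists 1 => // u su ut _.
    by rewrite !big_nil add0r ltW.
  by rewrite !big_nil add0r ltW.
rewrite (_ : (fun s t => _) = fun s t => F i s t + \sum_(j <- r) F j s t).
  exact: endpoint_lscD.
by apply/funext => s; apply/funext => t; rewrite big_cons.
Qed.

(** The exponent is already absorbed in [F], which will be a power of a norm or a sum of such
    powers; this makes the supremum superadditive. *)
Definition pvar F a b : R := sup [set psum F a p | p in itv_partition a b].

Lemma itv_partition_ex a b : a <= b -> exists p, itv_partition a b p.
Proof.
rewrite le_eqVlt => /orP[/eqP ->|ab]; first by exists [::]; split.
by exists [:: b]; exact: itv_partition1.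
Qed.

(** * Variation as a control *)

Section Pvar.
Variables (T C : R) (F : R -> R -> R).
Hypothesis F0 : forall s t, 0 <= F s t.
Hypothesis FC : forall p, itv_partition 0 T p -> psum F 0 p <= C.

Lemma psum_le_bound a b p : 0 <= a -> b <= T -> itv_partition a b p -> psum F a p <= C.
Proof.
move=> a0 bT hp.
have [q0 hq0] := itv_partition_ex a0; have [q1 hq1] := itv_partition_ex bT.
have := FC (itv_partition_cat hq0 (itv_partition_cat hp hq1)).
rewrite psum_cat; case: hq0 => _ /eqP ->; rewrite psum_cat; apply: le_trans.
by rewrite addrCA lerDl addr_ge0 // psum_ge0.
Qed.

Lemma pvar_has_sup a b : 0 <= a -> a <= b -> b <= T ->
  has_sup [set psum F a p | p in itv_partition a b].
Proof.
move=> a0 ab bT; split.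
  by have [q hq] := itv_partition_ex ab; exists (psum F a q); exists q.
by exists C => _ [p hp <-]; exact: psum_le_bound hp.
Qed.

Lemma pvar_ge a b p : 0 <= a -> b <= T -> itv_partition a b p -> psum F a p <= pvar F a b.
Proof.
move=> a0 bT hp; apply: sup_upper_bound; last by exists p.
by apply: pvar_has_sup => //; exact: itv_partition_le hp.
Qed.

Lemma pvar_ge1 a b : 0 <= a -> a < b -> b <= T -> F a b <= pvar F a b.
Proof.
by move=> a0 ab bT; have := pvar_ge a0 bT (itv_partition1 ab); rewrite /= addr0.
Qed.

Lemma pvar_le a b c : a <= b ->
  (forall p, itv_partition a b p -> psum F a p <= c) -> pvar F a b <= c.
Proof.
move=> ab h; apply: ge_sup; last by move=> _ [p hp <-]; exact: h.
by have [q hq] := itv_partition_ex ab; exists (psum F a q); exists q.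
Qed.

Lemma pvarxx a : pvar F a a = 0.
Proof.
rewrite /pvar (_ : [set _ | _ in _] = [set 0]) ?sup1 //.
apply/seteqP; split=> [_ [p hp <-]|_ ->]; first by rewrite (itv_partitionxx hp).
by exists [::] => //; split.
Qed.

Lemma pvar_control : control T (pvar F).
Proof.
split=> [s t s0 st tT|s t u s0 st tu uT].
  have [q hq] := itv_partition_ex st.
  by apply: le_trans (pvar_ge s0 tT hq); exact: psum_ge0.
have t0 : 0 <= t by apply: le_trans st.
have tT : t <= T by apply: le_trans uT.
rewrite -lerBrDr; apply: pvar_le => // p hp.
rewrite lerBrDr -lerBrDl; apply: pvar_le => // q hq.
rewrite lerBrDl; apply: le_trans (pvar_ge s0 uT (itv_partition_cat hp hq)).
by rewrite psum_cat; case: hp => _ /eqP ->.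
Qed.

Hypothesis F_lsc : endpoint_lsc T F.

(* Only the lower semicontinuity of [pvar F] in each variable is needed, and it is
   inherited from [F] as a supremum. *)
Lemma pvar_halving : halving T (pvar F).
Proof.
have [F_left F_right] := F_lsc.
move=> s t s0 st tT; set W := pvar F s t.
have cw := pvar_control.
have W0 : 0 <= W / 2 by rewrite divr_ge0 // cw.1.
(* The cut is [sup A]: to its left the variation from [s] is at most half, and to its right it
   exceeds half, so that superadditivity leaves less than half for the rest. *)
pose A := [set u | [/\ s <= u, u <= t & pvar F s u <= W / 2]].
have As : A s by split => //; rewrite pvarxx.
have hA : has_sup A by split; [exists s|exists t => u []].
have sm : s <= sup A by apply: sup_upper_bound.
have mt : sup A <= t by apply: ge_sup; [exists s|move=> u []].
have ltA u : s <= u -> u < sup A -> pvar F s u <= W / 2.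
  move=> su um; have h : 0 < sup A - u by rewrite subr_gt0.
  have [v [sv vt hv]] := sup_adherent h hA; rewrite subKr => uv.
  apply: le_trans hv; apply: (control_le cw) => //; first exact: ltW.
  exact: le_trans tT.
have gtA u : sup A < u -> u <= t -> W / 2 < pvar F s u.
  move=> mu ut; rewrite ltNge; apply/negP => h.
  have /(sup_upper_bound hA) : A u by split => //; apply: le_trans (ltW mu).
  by rewrite leNgt mu.
move: (sup A) sm mt ltA gtA => m sm mt ltA gtA {As hA A}.
exists m; split => //.
  move: sm; rewrite le_eqVlt => /orP[/eqP <-|sm]; first by rewrite pvarxx.
  apply: pvar_le; first exact: ltW.
  (* Only the last interval of a partition of [s, m] touches [m]; letting it end at a nearby [u < m]
     costs at most [e] and brings the partition under [ltA]. *)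
  case/lastP => [[_ /eqP/= sm']|p b [+ +]]; first by rewrite sm' ltxx in sm.
  rewrite last_rcons rcons_path => /andP[hp lb] /eqP bm; rewrite {b}bm in lb *.
  rewrite -cats1 psum_cat /= addr0; apply/ler_addgt0Pr => e e0.
  have /itv_partition_le sl : itv_partition s (last s p) p by split.
  have mT : m <= T by apply: le_trans tT.
  have [d d0 hd] := F_left _ _ _ (le_trans s0 sl) lb mT e0.
  pose u := Num.max ((last s p + m) / 2) (m - d / 2).
  have lu : last s p < u by rewrite lt_max; apply/orP; left; lra.
  have um : u < m by rewrite gt_max; apply/andP; split; lra.
  have mu : m - u < d by rewrite ltrBlDl -ltrBlDr lt_max; apply/orP; right; lra.
  have := hd u lu um mu.
  have : psum F s (p ++ [:: u]) <= W / 2.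
    apply: le_trans (ltA u _ um); last exact: ltW (le_lt_trans sl lu).
    apply: pvar_ge => //; first exact: le_trans (ltW um) mT.
    by split; [rewrite cats1 rcons_path hp lu|rewrite last_cat].
  by rewrite psum_cat /= addr0; lra.
move: mt; rewrite le_eqVlt => /orP[/eqP ->|mt]; first by rewrite pvarxx.
apply: pvar_le; first exact: ltW.
(* Symmetrically, the first interval of a partition of [m, t] is made to start at a nearby [u > m],
   where [gtA] applies. *)
case => [[_ /eqP/= sm']|b p [/= /andP[mb hp] lp]]; first by rewrite sm' ltxx in mt.
apply/ler_addgt0Pr => e e0.
have /itv_partition_le bt : itv_partition b t p by split.
have m0 : 0 <= m by apply: le_trans sm.
have [d d0 hd] := F_right _ _ _ m0 mb (le_trans bt tT) e0.
pose u := Num.min ((m + b) / 2) (m + d / 2).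
have ub : u < b by rewrite gt_min; apply/orP; left; lra.
have mu : m < u by rewrite lt_min; apply/andP; split; lra.
have um : u - m < d by rewrite ltrBlDl gt_min; apply/orP; right; lra.
have ut : u <= t by apply: le_trans bt; exact: ltW.
have h1 := hd u mu ub um.
have h2 := gtA u mu ut.
have h3 : pvar F s u + pvar F u t <= W by apply: cw.2 => //; apply: le_trans sm (ltW mu).
have h4 : psum F u (b :: p) <= pvar F u t.
  apply: pvar_ge => //; first exact: le_trans (ltW mu).
  by split => //=; rewrite ub.
move: h4 => /=; lra.
Qed.

End Pvar.

Lemma powR_lsc (a q e : R) : 0 <= a -> 0 < q -> 0 < e ->
  exists2 d : R, 0 < d & forall y, 0 <= y -> a <= y + d -> a `^ q <= y `^ q + e.
Proof.
move=> a0 q0 e0; have [ae|ea] := leP (a `^ q) e.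
  by exists 1 => // y y0 _; apply: le_trans ae _; rewrite lerDr powR_ge0.
(* At [b] the power has dropped by exactly [e], so monotonicity reduces the claim to [b <= y]. *)
pose b := (a `^ q - e) `^ q^-1.
have bq : b `^ q = a `^ q - e.
  by rewrite -powRrM mulVf ?gt_eqF // powRr1 // subr_ge0 ltW.
exists (a - b).
  rewrite subr_gt0 ltNge; apply/negP => ab.
  have : a `^ q <= b `^ q by apply: ge0_ler_powR; rewrite ?nnegrE ?powR_ge0 // ltW.
  by rewrite bq; lra.
move=> y y0 hy; rewrite -lerBlDr -bq.
apply: ge0_ler_powR; rewrite ?nnegrE ?powR_ge0 //; [exact: ltW|lra].
Qed.

(* The dyadic subdivision argument behind the sewing lemma: halving the control
   contracts the a priori bound [K], as [2 `^ (1 - th) < 1]. *)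
Lemma halving_bound T w D (th K B B' : R) : control T w -> halving T w ->
  1 < th -> 0 <= B -> 2 `^ (1 - th) * B' + B <= B' ->
  (forall s t, 0 <= s -> s <= t -> t <= T -> D s t <= K * w s t `^ th) ->
  (forall s m t (x : R), 0 <= s -> s <= m -> m <= t -> t <= T ->
     w s m <= x / 2 -> w m t <= x / 2 -> w s t = x ->
     D s t <= D s m + D m t + B * x `^ th) ->
  forall s t, 0 <= s -> s <= t -> t <= T -> D s t <= B' * w s t `^ th.
Proof.
move=> [w0 wD] hw th1 B0 hB' hK hD.
pose la := (2 : R) `^ (1 - th).
have la0 : 0 < la by apply: powR_gt0.
have la1 : la < 1.
  rewrite /la -opprB powRN invf_lt1 ?powR_gt0 //.
  rewrite -[ltLHS](congr1 (@^~ (th - 1)) (@powR1 R)).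
  by apply: gt0_ltr_powR; rewrite ?subr_gt0 ?nnegrE //; lra.
pose K' : R := `|K|.
have B'0 : 0 <= B'.
  have : B <= B' * (1 - la) by move: hB'; rewrite -/la; lra.
  by move=> /(le_trans B0); rewrite pmulr_lge0 // subr_gt0.
have step j s t : 0 <= s -> s <= t -> t <= T ->
    D s t <= (B' + la ^+ j * K') * w s t `^ th.
  elim: j s t => [|j IH] s t s0 st tT.
    apply: le_trans (hK _ _ s0 st tT) _; rewrite ler_wpM2r ?powR_ge0 //.
    by rewrite expr0 mul1r; apply: le_trans (ler_norm K) _; rewrite lerDr.
  have [m [sm mt h1 h2]] := hw _ _ s0 st tT.
  have m0 : 0 <= m by apply: le_trans sm.
  have mT : m <= T by apply: le_trans tT.
  apply: le_trans (hD _ _ _ _ s0 sm mt tT h1 h2 erefl) _.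
  have W0 := w0 _ _ s0 st tT.
  have co0 : 0 <= B' + la ^+ j * K'.
    apply: addr_ge0 => //; apply: mulr_ge0; last exact: normr_ge0.
    by apply: exprn_ge0; exact: ltW.
  have e2 : (w s t / 2) `^ th = la / 2 * w s t `^ th.
    rewrite powRM // mulrC; congr (_ * _).
    rewrite -[in LHS]powR_inv1 // -powRrM /la powRD; last by rewrite pnatr_eq0 implybT.
    by rewrite powRr1 // mulN1r mulrAC mulfV ?mul1r // pnatr_eq0.
  have half x y : 0 <= x -> x <= y -> y <= T -> w x y <= w s t / 2 ->
      D x y <= (B' + la ^+ j * K') * (la / 2 * w s t `^ th).
    move=> x0 xy yT hh; apply: le_trans (IH _ _ x0 xy yT) _.
    rewrite ler_wpM2l // -e2; apply: ge0_ler_powR => //; rewrite ?nnegrE ?w0 ?divr_ge0 //; lra.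
  apply: le_trans (lerD (lerD (half _ _ s0 sm mT h1) (half _ _ m0 mt tT h2)) (lexx _)) _.
  have -> : (B' + la ^+ j * K') * (la / 2 * w s t `^ th) +
      (B' + la ^+ j * K') * (la / 2 * w s t `^ th) + B * w s t `^ th = ((la * B' + B) + la ^+ j.+1 * K') * w s t `^ th by rewrite exprS; field.
  by rewrite ler_wpM2r ?powR_ge0 // lerD2r.
move=> s t s0 st tT; apply/ler_addgt0Pr => e e0.
have cv : (fun j => la ^+ j * (K' * w s t `^ th)) @ \oo --> (0 : R).
  rewrite -[X in _ --> X](mul0r (K' * w s t `^ th)); apply: cvgMl.
  by apply: cvg_expr; rewrite gtr0_norm.
move/cvgrPdist_lt: cv => /(_ e e0) [j _ /(_ j (leqnn j))].
rewrite sub0r normrN => /(le_lt_trans (ler_norm _)) hj.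
apply: le_trans (step j s t s0 st tT) _.
by rewrite mulrDl lerD2l -mulrA ltW.
Qed.

End Control.

(** * Tensor series *)

Section TensorRing.
Context {R : realType} {k : scalar_kind} {V : finNormedModType (scalars R k)}.
Local Notation K := (scalars R k).
Local Notation letter := 'I_(\dim {:V}).
Implicit Types (x y z g : tseries V) (w : seq letter).

(** Words of all lengths form a single index type, so identities between series can be checked
    coefficientwise without the degree casts of [tmul]. *)
Definition tcoef x w : K := x (size w) (in_tuple w).

Lemma tcoefE x n (t : n.-tuple letter) : tcoef x t = x n t.
Proof.
case: t => s hs; rewrite /tcoef /=; have e := eqP hs.
by case: n / e in hs *; congr (x _ _); exact: val_inj.
Qed.

Lemma tseries_ext x y : (forall w, tcoef x w = tcoef y w) -> x = y.
Proof.
move=> h; apply: functional_extensionality_dep => n; apply/ffunP => t.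
by rewrite -!tcoefE.
Qed.

Lemma ecast_tensor m n (e : m = n) (a : tensor V m) t :
  (ecast i (tensor V i) e a) t = a (tcast (esym e) t).
Proof. by case: n / e t => t; rewrite tcast_id. Qed.

Lemma tcoef_mul x y w : tcoef (tmul x y) w =
  \sum_(j < (size w).+1) tcoef x (take j w) * tcoef y (drop j w).
Proof.
rewrite /tcoef /tmul sum_ffunE; apply: eq_bigr => j _.
have jw : (j <= size w)%N by rewrite -ltnS.
rewrite ecast_tensor ffunE -!tcoefE; congr (tcoef _ _ * tcoef _ _).
  case: w j jw => [|a w] j jw.
    by apply/eqP; rewrite -size_eq0 size_tuple; case: j jw => -[].
  apply: (@eq_from_nth _ a); rewrite size_tuple ?size_takel // => i ij.
  by rewrite -(tnth_nth a _ (Ordinal ij)) tnth_mktuple (tnth_nth a) val_tcast /= nth_take.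
case: w j jw => [|a w] j jw.
  by apply/eqP; rewrite -size_eq0 size_tuple; case: j jw => -[].
apply: (@eq_from_nth _ a); rewrite size_tuple ?size_drop // => i ij.
by rewrite -(tnth_nth a _ (Ordinal ij)) tnth_mktuple (tnth_nth a) val_tcast /= nth_drop.
Qed.

Lemma tcoef_one w : tcoef (tone V) w = (w == [::])%:R.
Proof. by rewrite /tcoef ffunE size_eq0. Qed.

(* The left shift of a series by a letter turns the product into a recursion on words. *)
Definition tshift (a : letter) x : tseries V := fun n => [ffun t : n.-tuple letter => tcoef x (a :: t)].

Lemma tcoef_shift a x w : tcoef (tshift a x) w = tcoef x (a :: w).
Proof. by rewrite {1}/tcoef ffunE. Qed.

Lemma tcoef_mul_nil x y : tcoef (tmul x y) [::] = tcoef x [::] * tcoef y [::].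
Proof. by rewrite tcoef_mul big_ord1. Qed.

Lemma tcoef_mul_cons x y a w : tcoef (tmul x y) (a :: w) =
  tcoef x [::] * tcoef y (a :: w) + tcoef (tmul (tshift a x) y) w.
Proof.
rewrite !tcoef_mul big_ord_recl take0 drop0; congr (_ + _).
by apply: eq_bigr => j _; rewrite tcoef_shift.
Qed.

Definition tadd x y : tseries V := fun n => x n + y n.
Definition topp x : tseries V := fun n => - x n.
Definition tzero : tseries V := fun=> 0.
Definition tscale (c : K) x : tseries V := fun n => c *: x n.

Lemma tcoef_add x y w : tcoef (tadd x y) w = tcoef x w + tcoef y w.
Proof. by rewrite /tcoef /tadd ffunE. Qed.

Lemma tcoef_scale c x w : tcoef (tscale c x) w = c * tcoef x w.
Proof. by rewrite /tcoef /tscale ffunE. Qed.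

Lemma tmulDl : left_distributive (@tmul R k V) tadd.
Proof.
move=> x y z; apply: tseries_ext => w; rewrite tcoef_add !tcoef_mul -big_split.
by apply: eq_bigr => j _; rewrite tcoef_add mulrDl.
Qed.

Lemma tmulDr : right_distributive (@tmul R k V) tadd.
Proof.
move=> x y z; apply: tseries_ext => w; rewrite tcoef_add !tcoef_mul -big_split.
by apply: eq_bigr => j _; rewrite tcoef_add mulrDr.
Qed.

Lemma tmul_scalel c x y : tmul (tscale c x) y = tscale c (tmul x y).
Proof.
apply: tseries_ext => w; rewrite tcoef_scale !tcoef_mul mulr_sumr.
by apply: eq_bigr => j _; rewrite tcoef_scale mulrA.
Qed.

Lemma tmul_scaler c x y : tmul x (tscale c y) = tscale c (tmul x y).
Proof.
apply: tseries_ext => w; rewrite tcoef_scale !tcoef_mul mulr_sumr.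
by apply: eq_bigr => j _; rewrite tcoef_scale mulrCA.
Qed.

Lemma tmulA : associative (@tmul R k V).
Proof.
move=> x y z; apply: tseries_ext => w; elim: w x y z => [|a w IH] x y z.
  by rewrite !tcoef_mul_nil mulrA.
rewrite !tcoef_mul_cons IH mulrDr tcoef_mul_nil mulrA -addrA; congr (_ + _).
(* The shift obeys a twisted Leibniz rule, like a Fox derivative; it carries the induction on
   words. *)
have -> : tshift a (tmul x y) =
    tadd (tscale (tcoef x [::]) (tshift a y)) (tmul (tshift a x) y).
  by apply: tseries_ext => u; rewrite tcoef_add tcoef_scale !tcoef_shift tcoef_mul_cons.
by rewrite tmulDl tcoef_add tmul_scalel tcoef_scale.
Qed.

Lemma tmul1l : left_id (tone V) (@tmul R k V).
Proof.
move=> x; apply: tseries_ext => w; rewrite tcoef_mul big_ord_recl take0 drop0.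
rewrite tcoef_one eqxx mul1r big1 ?addr0 // => j _.
by rewrite tcoef_one -size_eq0 size_takel ?mul0r // lift0 ltn_ord.
Qed.

Lemma tmul1r : right_id (tone V) (@tmul R k V).
Proof.
move=> x; apply: tseries_ext => w; rewrite tcoef_mul big_ord_recr take_size drop_size.
rewrite tcoef_one eqxx mulr1 big1 /= ?add0r // => j _.
by rewrite tcoef_one -size_eq0 size_drop subn_eq0 leqNgt ltn_ord mulr0.
Qed.

HB.instance Definition _ := gen_eqMixin (tseries V).
HB.instance Definition _ := gen_choiceMixin (tseries V).

Lemma taddA : associative tadd.
Proof. by move=> x y z; apply: functional_extensionality_dep => n; exact: addrA. Qed.
Lemma taddC : commutative tadd.
Proof. by move=> x y; apply: functional_extensionality_dep => n; exact: addrC. Qed.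
Lemma tadd0 : left_id tzero tadd.
Proof. by move=> x; apply: functional_extensionality_dep => n; exact: add0r. Qed.
Lemma taddN : left_inverse tzero topp tadd.
Proof. by move=> x; apply: functional_extensionality_dep => n; exact: addNr. Qed.

HB.instance Definition _ := GRing.isZmodule.Build (tseries V) taddA taddC tadd0 taddN.

Lemma tone_neq0 : tone V != (0 : tseries V).
Proof.
apply/eqP => /(congr1 (fun x => tcoef x [::])); rewrite tcoef_one /tcoef ffunE.
by move/eqP; rewrite oner_eq0.
Qed.

HB.instance Definition _ := GRing.Zmodule_isNzRing.Build (tseries V)
  tmulA tmul1l tmul1r tmulDl tmulDr tone_neq0.

Lemma tsumE (J : Type) (r : seq J) (P : pred J) (F : J -> tseries V) n :
  (\sum_(i <- r | P i) F i) n = \sum_(i <- r | P i) F i n.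
Proof. by elim/big_rec2: _ => // i a b _ <-. Qed.

Lemma texpE x m : texp x m = x ^+ m.
Proof. by elim: m => // m IH; rewrite exprS -IH. Qed.

Lemma tmul_degree n x y : (x * y) n =
  \sum_(j < n.+1) ecast m (tensor V m) (subnKC (leq_ord j)) (tensor_prod (x j) (y (n - j)%N)).
Proof. by []. Qed.

Lemma tone_degree n : (0 < n)%N -> (1 : tseries V) n = 0.
Proof. by case: n => // n _; apply/ffunP => t; rewrite !ffunE. Qed.

Lemma tensor_prod0l m n (b : tensor V n) : tensor_prod (0 : tensor V m) b = 0.
Proof. by apply/ffunP => t; rewrite !ffunE mul0r. Qed.

Lemma tensor_prod0r m n (a : tensor V m) : tensor_prod a (0 : tensor V n) = 0.
Proof. by apply/ffunP => t; rewrite !ffunE mulr0. Qed.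

Lemma ecast_tensor0 m n (e : m = n) : ecast i (tensor V i) e (0 : tensor V m) = 0.
Proof. by case: n / e. Qed.

Lemma tmul_ext x y x' y' n :
  (forall m, (m <= n)%N -> x m = x' m) -> (forall m, (m <= n)%N -> y m = y' m) ->
  (x * y) n = (x' * y') n.
Proof.
move=> hx hy; rewrite !tmul_degree; apply: eq_bigr => j _.
have jn : (j <= n)%N by rewrite -ltnS.
by rewrite (hx j jn) (hy (n - j)%N (leq_subr _ _)).
Qed.

Lemma tmul_low x y a b n :
  (forall m, (m < a)%N -> x m = 0) -> (forall m, (m < b)%N -> y m = 0) ->
  (n < a + b)%N -> (x * y) n = 0.
Proof.
move=> hx hy nab; rewrite tmul_degree big1 // => j _.
have [ja|aj] := ltnP j a; first by rewrite hx // tensor_prod0l ecast_tensor0.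
rewrite (hy (n - j)%N) ?tensor_prod0r ?ecast_tensor0 //.
by have := ltn_ord j; lia.
Qed.

Lemma texp_low x m n : x 0 = 0 -> (n < m)%N -> (x ^+ m) n = 0.
Proof.
move=> x0; elim: m n => // m IH n nm; rewrite exprS.
by apply: (@tmul_low _ _ 1 m) => // -[].
Qed.

Lemma texp_ext x y m n : (forall i, (i <= n)%N -> x i = y i) ->
  ((x ^+ m) n = (y ^+ m) n).
Proof.
move=> h; elim: m n h => // m IH n h; rewrite !exprS.
by apply: tmul_ext => // i im; apply: IH => j ji; apply: h; apply: leq_trans im.
Qed.

(** Powers of [x - 1] above n vanish in degree n, so one finite sum computes all degrees below [M]
    at once, and ring identities apply to it. *)
Lemma tlogE x n M : x 0 = tone V 0 -> (n < M)%N ->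
  tlog x n = (\sum_(1 <= m < M) tscale ((-1) ^+ m.-1 / m%:R) ((x - 1) ^+ m)) n.
Proof.
move=> x0 nM; have h0 : (x - 1) 0 = 0 by rewrite /GRing.add /= /tadd x0 subrr.
rewrite tsumE (@big_cat_nat _ _ _ n.+1) //= [X in _ = _ + X]big_nat_cond.
rewrite [X in _ = _ + X]big1 ?addr0 => [|i /andP[/andP[ni _] _]].
  by apply: eq_bigr => i _; rewrite texpE.
by rewrite /tscale texp_low // scaler0.
Qed.

Lemma tinvE x n M : x 0 = tone V 0 -> (n < M)%N ->
  tinv x n = (\sum_(0 <= m < M) (1 - x) ^+ m) n.
Proof.
move=> x0 nM; have h0 : (1 - x) 0 = 0 by rewrite -[LHS]/(tone V 0 - x 0) x0 subrr.
rewrite tsumE (@big_cat_nat _ _ _ n.+1) //= [X in _ = _ + X]big_nat_cond.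
rewrite [X in _ = _ + X]big1 ?addr0 => [|i /andP[/andP[ni _] _]].
  by apply: eq_bigr => i _; rewrite texpE.
by rewrite texp_low.
Qed.

Lemma tinv_degree0 x : tinv x 0 = tone V 0.
Proof. by rewrite /tinv big_nat1. Qed.

(** The geometric sum telescopes to [1 - (1 - x) ^+ n.+1], whose last term is invisible in degree
    n. *)
Lemma tmulV x : x 0 = tone V 0 -> x * tinv x = 1.
Proof.
move=> x0; apply: functional_extensionality_dep => n.
have h0 : (1 - x) 0 = 0 by rewrite -[LHS]/(tone V 0 - x 0) x0 subrr.
transitivity ((x * \sum_(0 <= m < n.+1) (1 - x) ^+ m) n).
  by apply: tmul_ext => // m mn; exact: tinvE.
have -> : x * (\sum_(0 <= m < n.+1) (1 - x) ^+ m) = 1 - (1 - x) ^+ n.+1.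
  by rewrite big_mkord -[RHS]opprB subrX1 [1 - x - 1]addrAC subrr add0r mulNr opprK.
by rewrite -[LHS]/((1 : tseries V) n - ((1 - x) ^+ n.+1) n) texp_low // subr0.
Qed.

(** The right inverse of [x] has a right inverse too, which must then be [x]; so the inverse is
    two-sided. *)
Lemma tinvV x : x 0 = tone V 0 -> tinv x * x = 1.
Proof.
move=> x0; have h := tmulV x0; have h' := tmulV (tinv_degree0 x).
have e : x = tinv (tinv x) by rewrite -[LHS]mulr1 -h' mulrA h mul1r.
by rewrite [X in _ * X]e.
Qed.

Lemma tmul_degree0 x y : x 0 = tone V 0 -> y 0 = tone V 0 -> (x * y) 0 = tone V 0.
Proof.
move=> hx hy; rewrite -[RHS]/((1 : tseries V) 0) -[in RHS](mulr1 (1 : tseries V)).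
by apply: tmul_ext => m; rewrite leqn0 => /eqP ->.
Qed.

Lemma tinv_unique x y : x 0 = tone V 0 -> x * y = 1 -> y = tinv x.
Proof. by move=> x0 xy; rewrite -[y]mul1r -(tinvV x0) -mulrA xy mulr1. Qed.

Lemma tinvK x : x 0 = tone V 0 -> tinv (tinv x) = x.
Proof. by move=> x0; symmetry; apply: tinv_unique; rewrite ?tinv_degree0 ?tinvV. Qed.

Lemma tinvM x y : x 0 = tone V 0 -> y 0 = tone V 0 -> tinv (x * y) = tinv y * tinv x.
Proof.
move=> x0 y0; symmetry; apply: tinv_unique; first exact: tmul_degree0.
by rewrite mulrA -[x * y * _]mulrA tmulV // mulr1 tmulV.
Qed.

Lemma tinv1 : tinv 1 = 1 :> tseries V.
Proof. by symmetry; apply: tinv_unique => //; rewrite mulr1. Qed.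

Lemma tinv_ext x y n : (forall m, (m <= n)%N -> x m = y m) -> tinv x n = tinv y n.
Proof.
move=> h; rewrite /tinv; apply: eq_bigr => m _; rewrite !texpE.
by apply: texp_ext => i im; rewrite /tsub h.
Qed.

(** Conjugation by [g] is an algebra automorphism, hence commutes with every polynomial in [x - 1];
    in each degree the logarithm is such a polynomial. *)
Lemma tlog_conj g x : g 0 = tone V 0 -> x 0 = tone V 0 ->
  tlog (g * x * tinv g) = g * tlog x * tinv g.
Proof.
move=> g0 x0; apply: functional_extensionality_dep => n.
have V0 := tinv_degree0 g.
rewrite (@tlogE _ n n.+1) //; last by rewrite !tmul_degree0.
have -> : g * x * tinv g - 1 = g * (x - 1) * tinv g.
  by rewrite mulrBr mulrBl mulr1 tmulV.
transitivity ((g * (\sum_(1 <= m < n.+1) tscale ((-1) ^+ m.-1 / m%:R) ((x - 1) ^+ m)) * tinv g) n).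
  congr (_ n); rewrite mulr_sumr mulr_suml; apply: eq_bigr => m _.
  rewrite -[RHS]/(tmul (tmul _ _) _) tmul_scaler tmul_scalel; congr tscale.
  rewrite -[RHS]/(g * (x - 1) ^+ m * tinv g).
  elim: m => [|m IH]; first by rewrite !expr0 mulr1 tmulV.
  rewrite exprS IH exprS !mulrA; congr (_ * _ * _).
  by rewrite -[_ * tinv g * g]mulrA tinvV // mulr1.
apply: tmul_ext => // m mn; apply: tmul_ext => // i im.
by rewrite -tlogE // ltnS (leq_trans im).
Qed.

End TensorRing.

(** * Projective norms *)

Section FiniteDimension.
Context {R : realType}.

Lemma lipschitz_fun_continuous (W : normedModType R) (q : W -> R) M :
  (forall x y, `|q x - q y| <= `|x - y| * M) -> continuous q.
Proof.
move=> qM x; apply/cvgrPdist_lt => e e0.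
have M0 : 0 < `|M| + 1 by rewrite ltr_wpDl.
near=> y; apply: le_lt_trans (qM _ _) _.
apply: (@le_lt_trans _ _ (`|x - y| * (`|M| + 1))).
  by rewrite ler_wpM2l //; apply: le_trans (ler_norm _) _; rewrite lerDl.
rewrite -ltr_pdivlMr //; near: y.
by apply: cvgr_dist_lt => //; rewrite divr_gt0.
Unshelve. all: by end_near. Qed.

(** Equivalence of norms in finite dimension: [q] is Lipschitz, hence attains a minimum on the
    compact unit sphere, and this minimum is positive. With a bare function [q] on real rows, the
    lemma also serves complex spaces seen as real ones. *)
Lemma norm_rV_equiv m (q : 'rV[R]_m -> R) :
  (forall x y, q (x + y) <= q x + q y) -> (forall a x, q (a *: x) = `|a| * q x) ->
  (forall x, q x = 0 -> x = 0) ->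
  exists2 C : R, 0 <= C & forall (x : 'rV_m) i, `|x 0 i| <= C * q x.
Proof.
move=> qD qZ q_eq0.
have entry (x : 'rV[R]_m) i : `|x 0 i| <= `|x|.
  have /mapP[j Hj ->] : `|x 0 i| \in [seq `|x y.1 y.2| | y : 'I_1 * 'I_m].
    by apply/mapP; exists (ord0, i) => //=; rewrite mem_enum.
  by rewrite [leRHS]/Num.norm /= mx_normrE; apply/bigmax_geP; right => /=; exists j.
have q0 : q 0 = 0 by rewrite -(scale0r 0) qZ normr0 mul0r.
have qN x : q (- x) = q x by rewrite -scaleN1r qZ normrN1 mul1r.
have q_ge0 x : 0 <= q x by have := qD x (- x); rewrite subrr q0 qN; lra.
(* Without unit vectors the space is zero and [C = 0] works; otherwise the sphere is nonempty, as
   the extreme value theorem requires. *)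
have [[u u1]|noS] := pselect (exists u : 'rV[R]_m, `|u| = 1); last first.
  exists 0 => // x i; rewrite mul0r.
  suff -> : x = 0 by rewrite mxE normr0.
  apply/eqP; apply: contrapT => /negP x0; apply: noS; exists (`|x|^-1 *: x).
  by rewrite normrZ normfV normr_id mulVf // normr_eq0.
pose M := \sum_i q (delta_mx 0 i).
have qM x : q x <= `|x| * M.
  rewrite {1}(row_sum_delta x) mulr_sumr.
  elim/big_ind2: _ => [|a b c d ab cd|i _]; first by rewrite q0.
    by apply: le_trans (qD _ _) _; apply: lerD.
  by rewrite qZ ler_wpM2r.
have q_cont : continuous q.
  apply: (@lipschitz_fun_continuous _ q M) => x y.
  have h1 : q x - q y <= q (x - y).
    by rewrite lerBlDr; apply: le_trans _ (qD _ _); rewrite subrK.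
  have h2 : q y - q x <= q (x - y).
    by rewrite -(qN (x - y)) opprB lerBlDr; apply: le_trans _ (qD _ _); rewrite subrK.
  apply: le_trans (qM _); rewrite ler_norml; apply/andP; split; lra.
pose S := [set x : 'rV[R]_m | `|x| = 1].
have cS : compact S.
  apply: bounded_closed_compact.
    by exists 1; split => // z z1 x /= ->; exact: ltW.
  have := @closed_comp _ _ (@Num.norm R 'rV[R]_m) [set y | y = 1].
  by apply => //; move=> x _; exact: norm_continuous.
have [] := @EVT_min_rV R m q S _ cS; first by exists u.
  by apply: continuous_subspaceT.
move=> c; rewrite inE => cS1 hc.
have qc : 0 < q c.
  rewrite lt_neqAle q_ge0 andbT eq_sym; apply/eqP => /q_eq0 c0.
  by move: cS1; rewrite /S/= c0 normr0 => /eqP; rewrite eq_sym oner_eq0.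
exists (q c)^-1 => [|x i]; first by rewrite invr_ge0 ltW.
apply: le_trans (entry x i) _.
have [->|x0] := eqVneq x 0; first by rewrite normr0 q0 mulr0.
have nx : 0 < `|x| by rewrite normr_gt0.
have : q c <= q (`|x|^-1 *: x).
  by apply: hc; rewrite inE /S /= normrZ normfV normr_id mulVf // gt_eqF.
rewrite qZ normfV normr_id ler_pdivlMl // => h.
by rewrite ler_pdivlMl // mulrC.
Qed.

End FiniteDimension.

(** * Real-valued norms of scalars and vectors *)

Section ScalarNorm.
Context {R : realType} {k : scalar_kind}.
Local Notation K := (scalars R k).

Lemma real_part0 : real_part (0 : K) = 0.
Proof. by case: k. Qed.

Lemma real_part1 : real_part (1 : K) = 1.
Proof. by case: k. Qed.

Lemma real_partD (x y : K) : real_part (x + y) = real_part x + real_part y.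
Proof. by case: k x y => //= -[a b] [c d]. Qed.

Lemma real_part_ge0 (x : K) : 0 <= x -> 0 <= real_part x.
Proof. by case: k x => //= x; rewrite lecE => /andP[]. Qed.

Lemma real_part_le (x y : K) : x <= y -> real_part x <= real_part y.
Proof. by case: k x y => //= x y; rewrite lecE => /andP[]. Qed.

Lemma real_partM (x y : K) : 0 <= x -> 0 <= y -> real_part (x * y) = real_part x * real_part y.
Proof.
case: k x y => //= -[a b] [c d] /ger0_Im /= -> /ger0_Im /= ->.
by rewrite mul0r subr0.
Qed.

Lemma real_part_eq0 (x : K) : 0 <= x -> real_part x = 0 -> x = 0.
Proof. by case: k x => //= -[a b] /ger0_Im /= -> ->. Qed.

Definition knorm (c : K) : R := real_part `|c|.

Lemma knorm_ge0 c : 0 <= knorm c. Proof. exact: real_part_ge0. Qed.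
Lemma knorm0 : knorm 0 = 0. Proof. by rewrite /knorm normr0 real_part0. Qed.
Lemma knorm1 : knorm 1 = 1. Proof. by rewrite /knorm normr1 real_part1. Qed.
Lemma knormD c d : knorm (c + d) <= knorm c + knorm d.
Proof. by rewrite /knorm -real_partD real_part_le // ler_normD. Qed.
Lemma knormM c d : knorm (c * d) = knorm c * knorm d.
Proof. by rewrite /knorm normrM real_partM. Qed.
Lemma knormN c : knorm (- c) = knorm c. Proof. by rewrite /knorm normrN. Qed.
Lemma knorm_eq0 c : knorm c = 0 -> c = 0.
Proof. by move=> h; apply: normr0_eq0; exact: real_part_eq0. Qed.

Lemma knorm_prod n (F : 'I_n -> K) : knorm (\prod_i F i) = \prod_i knorm (F i).
Proof. by elim/big_rec2: _ => [|i a b _ <-]; rewrite ?knorm1 ?knormM. Qed.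

End ScalarNorm.

Section VectorNorm.
Context {R : realType} {k : scalar_kind} {V : finNormedModType (scalars R k)}.
Implicit Types v w : V.

Lemma vnorm_ge0 v : 0 <= vnorm v. Proof. exact: real_part_ge0. Qed.
Lemma vnormD v w : vnorm (v + w) <= vnorm v + vnorm w.
Proof. by rewrite /vnorm -real_partD real_part_le // ler_normD. Qed.
Lemma vnormZ c v : vnorm (c *: v) = knorm c * vnorm v.
Proof. by rewrite /vnorm normrZ real_partM. Qed.
Lemma vnorm_eq0 v : vnorm v = 0 -> v = 0.
Proof. by move=> h; apply: normr0_eq0; exact: real_part_eq0. Qed.

End VectorNorm.

(** A complex space of dimension d is treated as a real one of dimension d + d, each coordinate
    being split into real and imaginary part. The bound is what makes the projective norm
    definite. *)
Lemma coord_bounded (R : realType) (k : scalar_kind) (V : finNormedModType (scalars R k)) :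
  exists2 C : R, 0 <= C & forall (v : V) i, knorm (coord (vbasis {:V}) i v) <= C * vnorm v.
Proof.
case: k V => V; set d := \dim {:V}; pose b (i : 'I_d) := (vbasis {:V})`_i.
  pose comb (x : 'rV[R]_d) : V := \sum_(i < d) x 0 i *: b i.
  have [||x|C C0 hC] := @norm_rV_equiv R d (fun x => vnorm (comb x)).
  - move=> x y; suff -> : comb (x + y) = comb x + comb y by exact: vnormD.
    by rewrite /comb -big_split; apply: eq_bigr => i _; rewrite mxE scalerDl.
  - move=> a x; rewrite -[`|a|]/(@knorm R real_scalars a) -vnormZ /comb scaler_sumr.
    by congr vnorm; apply: eq_bigr => i _; rewrite mxE scalerA.
  - move/vnorm_eq0 => h; apply/rowP => i; rewrite mxE.
    have /freeP := basis_free (vbasisP {:V}); exact.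
  - exists C => // v i; pose x : 'rV[R]_d := \row_j coord (vbasis {:V}) j v.
    have := hC x i; rewrite mxE.
    suff -> : comb x = v by [].
    rewrite [RHS](coord_vbasis (memvf v)); apply: eq_bigr => j _.
    by rewrite mxE.
pose cx (x : 'rV[R]_(d + d)) i : R[i] := (x 0 (lshift d i) +i* x 0 (rshift d i))%C.
pose comb (x : 'rV[R]_(d + d)) : V := \sum_(i < d) cx x i *: b i.
have [||x|C C0 hC] := @norm_rV_equiv R (d + d) (fun x => vnorm (comb x)).
- move=> x y; suff -> : comb (x + y) = comb x + comb y by exact: vnormD.
  by rewrite /comb -big_split; apply: eq_bigr => i _ /=; rewrite -scalerDl /cx !mxE.
- move=> a x.
  have -> : `|a| = @knorm R complex_scalars (a%:C)%C.
    by rewrite /knorm /= expr0n addr0 sqrtr_sqr.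
  rewrite -vnormZ /comb scaler_sumr; congr vnorm; apply: eq_bigr => i _.
  rewrite scalerA /cx !mxE; congr (_ *: _); apply/eqP; rewrite eq_complex /=.
  by rewrite !mul0r subr0 addr0 !eqxx.
- move/vnorm_eq0 => h.
  have {}h i : cx x i = 0 by have /freeP := basis_free (vbasisP {:V}); exact.
  apply/rowP => i; rewrite mxE; case: (split_ordP i) => j ->.
    by have [] := h j.
  by have [] := h j.
(* The modulus of a coordinate is at most the sum of the moduli of its real and imaginary parts,
   each bounded with constant [C]. *)
- exists (C + C) => [|v i]; first exact: addr_ge0.
  pose x : 'rV[R]_(d + d) := row_mx (\row_j complex.Re (coord (vbasis {:V}) j v))
     (\row_j complex.Im (coord (vbasis {:V}) j v)).
  have cxE j : cx x j = coord (vbasis {:V}) j v.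
    by rewrite /cx row_mxEl row_mxEr !mxE; case: (coord _ _ _).
  have e : comb x = v.
    by rewrite [RHS](coord_vbasis (memvf v)); apply: eq_bigr => j _; rewrite cxE.
  have := hC x (lshift d i); have := hC x (rshift d i); rewrite e.
  rewrite -cxE /cx; set a := x 0 _; set c := x 0 _ => hc ha.
  rewrite mulrDl; apply: le_trans (lerD ha hc).
  rewrite (_ : a +i* c = a%:C + (0 +i* c))%C; last first.
    by apply/eqP; rewrite eq_complex /= addr0 add0r !eqxx.
  apply: le_trans (knormD _ _) _.
  by rewrite /knorm /= !expr0n addr0 add0r !sqrtr_sqr.
Qed.

(** * The projective norm: definiteness and submultiplicativity *)

Section ProjectiveNorm.
Context {R : realType} {k : scalar_kind} {V : finNormedModType (scalars R k)}.
Local Notation K := (scalars R k).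
Local Notation letter := 'I_(\dim {:V}).
Local Notation basis i := ((vbasis {:V})`_i).
Local Notation "`|[ a ]|" := (@projective_norm R k V _ a) (at level 0, a at level 99).

Lemma projective_norm_degree0 (a : tensor V 0) : `|[a]| = knorm (a [tuple]).
Proof. by []. Qed.

Lemma pure_tensor_scale n (v : 'I_n -> V) (i0 : 'I_n) c :
  pure_tensor (fun i => if i == i0 then c *: v i else v i) = c *: pure_tensor v.
Proof.
apply/ffunP => w; rewrite !ffunE (bigD1 i0) //= eqxx linearZ /= -mulrA.
rewrite [in RHS](bigD1 i0) //=; congr (_ * (_ * _)).
by apply: eq_bigr => i /negPf ->.
Qed.

Lemma pure_tensor_basis n (u w : n.-tuple letter) :
  pure_tensor (fun i => basis (tnth u i)) w = (w == u)%:R.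
Proof.
rewrite ffunE; have hf := basis_free (vbasisP {:V}).
under eq_bigr do rewrite coord_free //.
have [->|wu] := eqVneq w u; first by rewrite big1 // => i _; rewrite eqxx.
have [i hi] : exists i, tnth w i != tnth u i.
  apply: contrapT => h; case/eqP: wu; apply: eq_from_tnth => i.
  by apply/eqP; apply: contrapT => /negP hi; apply: h; exists i.
by rewrite (bigD1 i) //= eq_sym (negPf hi) mul0r.
Qed.

Lemma tensor_span n (a : tensor V n) : (0 < n)%N ->
  exists (J : finType) (v : J -> 'I_n -> V), a = \sum_j pure_tensor (v j).
Proof.
move=> n0; exists (n.-tuple letter : finType).
(* The coefficient is absorbed by the first factor, which is why the degree has to be positive. *)
exists (fun u i => if i == Ordinal n0 then a u *: basis (tnth u i) else basis (tnth u i)).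
apply/ffunP => w; rewrite sum_ffunE (bigD1 w) //= pure_tensor_scale ffunE.
rewrite pure_tensor_basis eqxx big1 => [|u uw].
  by rewrite addr0 -[RHS]/(a w * 1) mulr1.
rewrite pure_tensor_scale ffunE pure_tensor_basis eq_sym (negPf uw).
exact: mulr0.
Qed.

(** Allowing any finite index type lets representations of sums and products be indexed by [J + L]
    and [J * L]. *)
Lemma projective_norm_le n (J : finType) (v : J -> 'I_n -> V) : (0 < n)%N ->
  `|[\sum_j pure_tensor (v j)]| <= \sum_j \prod_(i < n) vnorm (v j i).
Proof.
case: n v => // n v _; apply: ge_inf.
  by exists 0 => _ [J' [v' [_ ->]]]; apply: sumr_ge0 => j _; apply: prodr_ge0 => i _; exact: vnorm_ge0.
exists #|J|, (fun j => v (enum_val j)); split.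
  by rewrite (reindex (@enum_val J predT)) //; exact/onW_bij/enum_val_bij.
by rewrite (reindex (@enum_val J predT)) //; exact/onW_bij/enum_val_bij.
Qed.

Lemma projective_norm_approx n (a : tensor V n) e : (0 < n)%N -> 0 < e ->
  exists (J : finType) (v : J -> 'I_n -> V), a = \sum_j pure_tensor (v j) /\
    \sum_j \prod_(i < n) vnorm (v j i) <= `|[a]| + e.
Proof.
case: n a => // n a _ e0.
have [|r [J [v [av ->]]] hr] := @inf_adherent _ [set r | exists (J : nat) (v : 'I_J -> 'I_n.+1 -> V),
             a = \sum_(j < J) pure_tensor (v j) /\
             r = \sum_(j < J) \prod_(i < n.+1) vnorm (v j i)] _ e0.
  split; last first.
    by exists 0 => _ [J' [v' [_ ->]]]; apply: sumr_ge0 => j _; apply: prodr_ge0 => i _; exact: vnorm_ge0.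
  have [J [v av]] := tensor_span a (ltn0Sn n).
  exists (\sum_(j < #|J|) \prod_(i < n.+1) vnorm (v (enum_val j) i)).
  exists #|J|, (fun j => v (enum_val j)); split => //.
  by rewrite av (reindex (@enum_val J predT)) //; exact/onW_bij/enum_val_bij.
by exists 'I_J, v; split => //; exact: ltW.
Qed.

Lemma projective_norm_ge0 n (a : tensor V n) : 0 <= `|[a]|.
Proof.
case: n a => [|n] a; first exact: knorm_ge0.
apply/ler_addgt0Pr => e e0.
have [J [v [_ h]]] := projective_norm_approx a (ltn0Sn n) e0.
by apply: le_trans h; apply: sumr_ge0 => j _; apply: prodr_ge0 => i _; exact: vnorm_ge0.
Qed.

Lemma projective_norm0 n : `|[0 : tensor V n]| = 0.
Proof.
case: n => [|n]; first by rewrite projective_norm_degree0 ffunE knorm0.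
apply: le_anti; rewrite projective_norm_ge0 andbT.
have := @projective_norm_le n.+1 void (fun j => match j with end) (ltn0Sn n).
by rewrite !big_pred0 //; case.
Qed.

Lemma projective_normD n (a b : tensor V n) : `|[a + b]| <= `|[a]| + `|[b]|.
Proof.
case: n a b => [|n] a b; first by rewrite !projective_norm_degree0 ffunE knormD.
apply/ler_addgt0Pr => e e0.
have [|J [v [-> hv]]] := projective_norm_approx a (ltn0Sn n) (_ : 0 < e / 2).
  by rewrite divr_gt0.
have [|L [u [-> hu]]] := projective_norm_approx b (ltn0Sn n) (_ : 0 < e / 2).
  by rewrite divr_gt0.
pose vu (j : J + L) := match j with inl j => v j | inr l => u l end.
have := projective_norm_le vu (ltn0Sn n).
rewrite !big_sumType /= => h; apply: le_trans h _.
by move: hv hu; lra.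
Qed.

Lemma projective_normZ n c (a : tensor V n) : `|[c *: a]| <= knorm c * `|[a]|.
Proof.
case: n a => [|n] a; first by rewrite !projective_norm_degree0 ffunE -knormM.
apply/ler_addgt0Pr => e e0.
have c1 : 0 < knorm c + 1 by rewrite ltr_wpDl // knorm_ge0.
have [|J [v [-> hv]]] := projective_norm_approx a (ltn0Sn n) (_ : 0 < e / (knorm c + 1)).
  by rewrite divr_gt0.
rewrite scaler_sumr; under eq_bigr do rewrite -(pure_tensor_scale _ ord0).
apply: le_trans (projective_norm_le _ (ltn0Sn n)) _.
under eq_bigr => j _.
  rewrite big_ord_recl /= vnormZ -mulrA.
  under eq_bigr do rewrite /=.
  over.
rewrite -mulr_sumr.
have -> : \sum_j vnorm (v j ord0) * \prod_(i < n) vnorm (v j (lift ord0 i)) =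
  \sum_j \prod_(i < n.+1) vnorm (v j i) by apply: eq_bigr => j _; rewrite big_ord_recl.
apply: le_trans (ler_wpM2l (knorm_ge0 c) hv) _.
rewrite mulrDr lerD2l mulrCA -[leRHS]mulr1 ler_wpM2l ?ltW //.
by rewrite ltr_pdivrMr // mul1r ltrDl.
Qed.

Lemma projective_normN n (a : tensor V n) : `|[- a]| = `|[a]|.
Proof.
have h (b : tensor V n) : `|[- b]| <= `|[b]|.
  by rewrite -scaleN1r; apply: le_trans (projective_normZ _ _) _; rewrite knormN knorm1 mul1r.
by apply: le_anti; rewrite h -{1}(opprK a) h.
Qed.

Lemma projective_normB n (a b : tensor V n) : `|[a - b]| = `|[b - a]|.
Proof. by rewrite -projective_normN opprB. Qed.

Lemma projective_norm_sum n I (r : seq I) (P : pred I) (F : I -> tensor V n) :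
  `|[\sum_(i <- r | P i) F i]| <= \sum_(i <- r | P i) `|[F i]|.
Proof.
elim/big_rec2: _ => [|i a b _ h]; first by rewrite projective_norm0.
by apply: le_trans (projective_normD _ _) _; rewrite lerD2l.
Qed.

(** Each coefficient of a pure tensor is a product of n coordinates, hence at most [C ^+ n] times
    the product of the norms; a representation of small cost thus forces small coefficients. *)
Lemma projective_norm_eq0 n (a : tensor V n) : `|[a]| = 0 -> a = 0.
Proof.
move=> a0; have [C C0 hC] := coord_bounded V.
apply/ffunP => w; rewrite [RHS]ffunE; apply: knorm_eq0; apply: le_anti.
rewrite knorm_ge0 andbT; case: n a w a0 => [|n] a w a0.
  by rewrite (tuple0 w) -projective_norm_degree0 a0.
have D0 : 0 < C ^+ n.+1 + 1 by rewrite ltr_wpDl // exprn_ge0.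
apply/ler_addgt0Pr => e e0; rewrite add0r.
have [|J [v [av hv]]] := projective_norm_approx a (ltn0Sn n) (_ : 0 < e / (C ^+ n.+1 + 1)).
  by rewrite divr_gt0.
rewrite av sum_ffunE.
have h : knorm (\sum_j pure_tensor (v j) w) <= C ^+ n.+1 * \sum_j \prod_(i < n.+1) vnorm (v j i).
  rewrite mulr_sumr; elim/big_rec2: _ => [|j x y _ h]; first by rewrite knorm0.
  apply: le_trans (knormD _ _) _; apply: lerD => //.
  rewrite ffunE knorm_prod -[X in C ^+ X]card_ord -prodr_const -big_split /=.
  by apply: ler_prod => i _; rewrite knorm_ge0 hC.
apply: le_trans h _; rewrite a0 add0r in hv.
apply: le_trans (ler_wpM2l (exprn_ge0 _ C0) hv) _.
by rewrite mulrCA -[leRHS]mulr1 ler_wpM2l ?ltW // ltr_pdivrMr // mul1r ltrDl.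
Qed.

Lemma projective_norm_ecast m n (e : m = n) (a : tensor V m) :
  `|[ecast i (tensor V i) e a]| = `|[a]|.
Proof. by case: n / e. Qed.

Lemma tensor_prod_pure m n (v : 'I_m -> V) (u : 'I_n -> V) :
  tensor_prod (pure_tensor v) (pure_tensor u) =
  pure_tensor (fun i => match fintype.split i with inl j => v j | inr l => u l end).
Proof.
apply/ffunP => w; rewrite !ffunE big_split_ord; congr (_ * _).
  by apply: eq_bigr => i _; rewrite tnth_mktuple (unsplitK (inl i)).
by apply: eq_bigr => i _; rewrite tnth_mktuple (unsplitK (inr i)).
Qed.

Lemma tensor_prod_suml m n J (r : seq J) (F : J -> tensor V m) (b : tensor V n) :
  tensor_prod (\sum_(j <- r) F j) b = \sum_(j <- r) tensor_prod (F j) b.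
Proof.
apply/ffunP => w; rewrite ffunE !sum_ffunE big_distrl.
by apply: eq_bigr => j _; rewrite ffunE.
Qed.

Lemma tensor_prod_sumr m n J (r : seq J) (a : tensor V m) (F : J -> tensor V n) :
  tensor_prod a (\sum_(j <- r) F j) = \sum_(j <- r) tensor_prod a (F j).
Proof.
apply/ffunP => w; rewrite ffunE !sum_ffunE big_distrr.
by apply: eq_bigr => j _; rewrite ffunE.
Qed.

(** Multiplying out near-optimal representations of both factors gives one of the product whose cost
    is the product of the costs. Degree 0 is separate, since its norm is the modulus. *)
Lemma projective_norm_prod m n (a : tensor V m) (b : tensor V n) :
  `|[tensor_prod a b]| <= `|[a]| * `|[b]|.
Proof.
case: m a => [|m] a.
  rewrite projective_norm_degree0.
  have -> : tensor_prod a b = a [tuple] *: b.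
    apply/ffunP => w; rewrite !ffunE (tuple0 (mktuple _)) -[RHS]/(a [tuple] * b w).
    by congr (_ * b _); apply: eq_from_tnth => i; rewrite tnth_mktuple; congr tnth; exact: val_inj.
  exact: projective_normZ.
case: n b => [|n] b.
  rewrite (projective_norm_degree0 b) mulrC.
  have -> : tensor_prod a b = ecast i (tensor V i) (esym (addn0 m.+1)) (b [tuple] *: a).
    apply/ffunP => w; rewrite ecast_tensor !ffunE (tuple0 (mktuple (fun i : 'I_0 => _))).
    rewrite mulrC -[RHS]/(b [tuple] * a _); congr (_ * a _); apply: eq_from_tnth => i.
    by rewrite tnth_mktuple tcastE; congr tnth; exact: val_inj.
  by rewrite projective_norm_ecast; exact: projective_normZ.
apply/ler_addgt0Pr => e e0.
(* With d = e / M <= 1, the error d * ([|[a]| +]|[b]| + d) of the product is at most d * M = e. *)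
pose M := `|[a]| + `|[b]| + 1 + e.
have a_ge0 := projective_norm_ge0 a; have b_ge0 := projective_norm_ge0 b.
have M0 : 0 < M by rewrite /M; lra.
have d0 : 0 < e / M by rewrite divr_gt0.
have dM : e / M * M = e by rewrite divfK // gt_eqF.
have d1 : e / M <= 1 by rewrite ler_pdivrMr // mul1r /M; lra.
have [J [v [av hv]]] := projective_norm_approx a (ltn0Sn m) d0.
have [L [u [bu hu]]] := projective_norm_approx b (ltn0Sn n) d0.
pose vu (jl : J * L) i := match fintype.split i with inl i => v jl.1 i | inr i => u jl.2 i end.
have -> : tensor_prod a b = \sum_jl pure_tensor (vu jl).
  rewrite av tensor_prod_suml.
  transitivity (\sum_j \sum_l tensor_prod (pure_tensor (v j)) (pure_tensor (u l))).
    by apply: eq_bigr => j _; rewrite bu tensor_prod_sumr.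
  by rewrite pair_big; apply: eq_bigr => jl _; rewrite tensor_prod_pure.
apply: le_trans (projective_norm_le vu _) _ => //.
have -> : \sum_j \prod_(i < m.+1 + n.+1) vnorm (vu j i) =
   (\sum_j \prod_(i < m.+1) vnorm (v j i)) * (\sum_l \prod_(i < n.+1) vnorm (u l i)).
  rewrite big_distrl; under [RHS]eq_bigr do rewrite big_distrr.
  rewrite pair_big; apply: eq_bigr => jl _; rewrite big_split_ord; congr (_ * _).
    by apply: eq_bigr => i _; rewrite /vu (unsplitK (inl i)).
  by apply: eq_bigr => i _; rewrite /vu (unsplitK (inr i)).
apply: le_trans (ler_pM _ _ hv hu) _.
- by apply: sumr_ge0 => j _; apply: prodr_ge0 => i _; exact: vnorm_ge0.
- by apply: sumr_ge0 => j _; apply: prodr_ge0 => i _; exact: vnorm_ge0.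
rewrite mulrDl !mulrDr -addrA lerD2l.
move: (e / M) dM d0 d1 => d; rewrite /M => dM d0 d1.
have h : d * d <= d * 1 by apply: ler_wpM2l => //; exact: ltW.
have h' : 0 <= d * e by rewrite mulr_ge0 // ltW.
lra.
Qed.

Lemma projective_norm_mul (x y : tseries V) n :
  `|[(x * y) n]| <= \sum_(j < n.+1) `|[x j]| * `|[y (n - j)%N]|.
Proof.
rewrite tmul_degree; apply: le_trans (projective_norm_sum _ _ _) _.
apply: ler_sum => j _; rewrite projective_norm_ecast; exact: projective_norm_prod.
Qed.

Lemma projective_norm_tone0 : `|[tone V 0]| = 1.
Proof. by rewrite projective_norm_degree0 ffunE knorm1. Qed.

End ProjectiveNorm.

(** * Radius of convergence through weighted sums of norms *)

Section Radius.
Context {R : realType} {k : scalar_kind} {V : finNormedModType (scalars R k)}.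
Implicit Types x y : tseries V.
Local Notation "`|[ a ]|" := (@projective_norm R k V _ a) (at level 0, a at level 99).

Definition norm_summable (r : R) x :=
  exists C, forall m, \sum_(n < m) `|[x n]| * r ^+ n <= C.

Lemma infinite_radiusP x : infinite_radius x <-> forall r, 0 <= r -> norm_summable r x.
Proof.
have mono z : 0 <= z -> nondecreasing_seq (pseries (fun n => `|[x n]|) z).
  move=> z0; apply/nondecreasing_seqP => n; rewrite /pseries /series /= big_nat_recr //=.
  by rewrite lerDl mulr_ge0 ?exprn_ge0 // projective_norm_ge0.
rewrite /infinite_radius /radius_of_convergence; split=> [h r r0|h].
  have [z [z0 cz] rz] : exists2 z, 0 <= z /\ cvgn (pseries (fun n => `|[x n]|) z) & r < z.
    apply: contrapT => no; suff : (+oo <= r%:E)%E by [].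
    rewrite -h; apply: ge_ereal_sup => _ [z [z0 cz] <-]; rewrite lee_fin leNgt.
    by apply/negP => rz; apply: no; exists z.
  exists (limn (pseries (fun n => `|[x n]|) z)) => m.
  apply: le_trans (nondecreasing_cvgn_le (mono z z0) cz m).
  rewrite /pseries /series /= big_mkord; apply: ler_sum => n _.
  by rewrite ler_wpM2l ?projective_norm_ge0 // lerXn2r // ltW.
apply/eqyP => A A0; apply: ereal_sup_ubound; exists A => //; split; first exact: ltW.
apply: nondecreasing_is_cvgn; first by apply: mono; exact: ltW.
have [C hC] := h A (ltW A0); exists C => _ [n _ <-].
by rewrite /pseries /series /= big_mkord.
Qed.

(** The left side sums over a triangle of index pairs contained in the square on the right. *)
Lemma sum_convolution_le (a b : nat -> R) m :
  (forall n, 0 <= a n) -> (forall n, 0 <= b n) ->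
  \sum_(n < m) \sum_(j < n.+1) a j * b (n - j)%N <= (\sum_(n < m) a n) * (\sum_(n < m) b n).
Proof.
move=> + b0; elim: m a => [|m IH] a a0; first by rewrite !big_ord0 mulr0.
under eq_bigr do rewrite big_ord_recl subn0.
rewrite big_split /= -mulr_sumr [X in _ + X]big_ord_recl /= big_ord0 add0r.
rewrite [X in _ <= X * _]big_ord_recl mulrDl lerD2l.
apply: le_trans (IH (a \o succn) (fun n => a0 _)) _.
apply: ler_wpM2l; first by apply: sumr_ge0 => i _; exact: a0.
by rewrite [leRHS]big_ord_recr lerDl.
Qed.

Lemma norm_summable_mul r x y : 0 <= r ->
  norm_summable r x -> norm_summable r y -> norm_summable r (x * y).
Proof.
move=> r0 [C hC] [D hD]; exists (C * D) => m.
pose a n := `|[x n]| * r ^+ n; pose b n := `|[y n]| * r ^+ n.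
have a0 n : 0 <= a n by rewrite mulr_ge0 ?exprn_ge0 // projective_norm_ge0.
have b0 n : 0 <= b n by rewrite mulr_ge0 ?exprn_ge0 // projective_norm_ge0.
apply: le_trans (ler_pM _ _ (hC m) (hD m)); last 2 first.
- by apply: sumr_ge0 => n _; exact: a0.
- by apply: sumr_ge0 => n _; exact: b0.
apply: le_trans (sum_convolution_le m a0 b0); apply: ler_sum => n _.
apply: le_trans (ler_wpM2r (exprn_ge0 _ r0) (projective_norm_mul x y n)) _.
rewrite mulr_suml; apply: ler_sum => j _.
have jn : (j <= n)%N by rewrite -ltnS.
by rewrite /a /b mulrACA -exprD subnKC.
Qed.

Lemma infinite_radius_mul x y :
  infinite_radius x -> infinite_radius y -> infinite_radius (x * y).
Proof.
move=> /infinite_radiusP hx /infinite_radiusP hy; apply/infinite_radiusP => r r0.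
by apply: norm_summable_mul; [|exact: hx|exact: hy].
Qed.

Lemma infinite_radius_conj (g x : tseries V) : g 0 = tone V 0 ->
  infinite_radius g -> infinite_radius (tinv g) ->
  infinite_radius x <-> infinite_radius (g * x * tinv g).
Proof.
move=> g0 rg rV; split=> h; first exact: infinite_radius_mul (infinite_radius_mul rg h) rV.
have -> : x = tinv g * (g * x * tinv g) * g.
  by rewrite !mulrA tinvV // mul1r -mulrA tinvV // mulr1.
exact: infinite_radius_mul (infinite_radius_mul rV h) rg.
Qed.

Lemma norm_summable_geometric r x (c q : R) : 0 <= c -> 0 <= q -> 0 <= r -> q * r <= 2^-1 ->
  (forall n, `|[x n]| <= c * q ^+ n) -> norm_summable r x.
Proof.
move=> c0 q0 r0 qr hx; exists (c * 2) => m.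
apply: (@le_trans _ _ (\sum_(n < m) c * 2^-1 ^+ n)).
  apply: ler_sum => n _; apply: le_trans (ler_wpM2r (exprn_ge0 _ r0) (hx n)) _.
  by rewrite -mulrA ler_wpM2l // -exprMn lerXn2r // nnegrE ?mulr_ge0.
rewrite -mulr_sumr ler_wpM2l //.
suff -> : \sum_(n < m) (2^-1 : R) ^+ n = 2 - 2 * 2^-1 ^+ m.
  by rewrite gerBl mulr_ge0 // exprn_ge0.
elim: m => [|m IH]; first by rewrite big_ord0 expr0 mulr1 subrr.
by rewrite big_ord_recr /= IH exprS; lra.
Qed.

End Radius.

(** * Multiplicative families of finite variation *)

Section Convergence.
Context {R : realType} {k : scalar_kind} {V : finNormedModType (scalars R k)}.
Local Notation "`|[ a ]|" := (@projective_norm R k V _ a) (at level 0, a at level 99).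
Context {A : Type} (F : set_system A) {FF : Filter F}.
Implicit Types (f g : A -> tseries V) (x y : tseries V).

(** This is convergence in the product topology; product and inversion are continuous for it because
    each degree involves finitely many others. *)
Definition tcvg f x := forall n, `|[f a n - x n]| @[a --> F] --> (0 : R).

Lemma cvg0_le (u v : A -> R) : (forall a, 0 <= u a) -> (forall a, u a <= v a) ->
  v @ F --> (0 : R) -> u @ F --> (0 : R).
Proof.
move=> u0 uv hv; apply: (@squeeze_cvgr _ _ _ _ (fun=> 0) v) => //; last exact: cvg_cst.
by apply: nearW => a; rewrite u0 uv.
Qed.

Lemma cvg0_sum (I : Type) (r : seq I) (u : I -> A -> R) :
  (forall i, u i @ F --> (0 : R)) -> (fun a => \sum_(i <- r) u i a) @ F --> (0 : R).
Proof.
move=> hu; elim: r => [|i r IH].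
  by under eq_fun do rewrite big_nil; exact: cvg_cst.
rewrite (_ : (fun a => _) = fun a => u i a + \sum_(j <- r) u j a); last first.
  by apply/funext => a; rewrite big_cons.
by rewrite -[X in _ --> X](addr0 (0 : R)); apply: cvgD.
Qed.

Lemma cvg0M (u v : A -> R) : u @ F --> (0 : R) -> v @ F --> (0 : R) ->
  (fun a => u a * v a) @ F --> (0 : R).
Proof. by move=> hu hv; rewrite -[X in _ --> X](mulr0 (0 : R)); apply: cvgM. Qed.

Lemma cvg0Z (c : R) (u : A -> R) : u @ F --> (0 : R) -> (fun a => c * u a) @ F --> (0 : R).
Proof. by move=> hu; rewrite -[X in _ --> X](mulr0 c); apply: cvgZr. Qed.

Lemma tcvg_cst x : tcvg (fun=> x) x.
Proof. by move=> n; rewrite subrr projective_norm0; exact: cvg_cst. Qed.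

Lemma tcvgM f g x y : tcvg f x -> tcvg g y -> tcvg (fun a => f a * g a) (x * y).
Proof.
move=> hf hg n.
apply: (@cvg0_le _ (fun a => \sum_(j < n.+1) (`|[f a j - x j]| * `|[g a (n - j)%N - y (n - j)%N]|)
   + (\sum_(j < n.+1) (`|[y (n - j)%N]| * `|[f a j - x j]|)
   + \sum_(j < n.+1) (`|[x j]| * `|[g a (n - j)%N - y (n - j)%N]|)))) => [a|a|].
- exact: projective_norm_ge0.
- have -> : (f a * g a) n - (x * y) n =
     ((f a - x) * (g a - y)) n + (((f a - x) * y) n + (x * (g a - y)) n).
    rewrite -[LHS]/((f a * g a - x * y) n).
    rewrite -[RHS]/(((f a - x) * (g a - y) + ((f a - x) * y + x * (g a - y))) n).
    congr (_ n); rewrite addrA -mulrDr subrK mulrBl mulrBr.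
    by rewrite [RHS]addrA subrK.
  apply: le_trans (projective_normD _ _) _; apply: lerD; first exact: projective_norm_mul.
  apply: le_trans (projective_normD _ _) _; apply: lerD; last exact: projective_norm_mul.
  apply: le_trans (projective_norm_mul _ _ _) _.
  by apply: ler_sum => j _; rewrite mulrC.
- rewrite -[X in _ --> X](addr0 (0 : R)); apply: cvgD.
    by apply: cvg0_sum => j; apply: cvg0M; [exact: hf|exact: hg].
  rewrite -[X in _ --> X](addr0 (0 : R)); apply: cvgD.
    by apply: cvg0_sum => j; apply: cvg0Z; exact: hf.
  by apply: cvg0_sum => j; apply: cvg0Z; exact: hg.
Qed.

Lemma tcvgX f x m : tcvg f x -> tcvg (fun a => f a ^+ m) (x ^+ m).
Proof.
move=> hf; elim: m => [|m IH]; first exact: tcvg_cst.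
under [X in tcvg X]eq_fun do rewrite exprS.
by rewrite exprS; apply: tcvgM.
Qed.

Lemma tcvg_inv f x : tcvg f x -> tcvg (fun a => tinv (f a)) (tinv x).
Proof.
move=> hf n.
have h1 : tcvg (fun a => 1 - f a) (1 - x).
  move=> i; apply: cvg_trans (hf i); apply: near_eq_cvg; apply: nearW => a.
  rewrite -[in RHS]projective_normN; congr projective_norm.
  rewrite -[RHS]/(- ((1 : tseries V) i - f a i - ((1 : tseries V) i - x i))).
  by rewrite !opprB [RHS]addrC addrA subrK.
apply: (@cvg0_le _ (fun a => \sum_(0 <= m < n.+1) `|[((1 - f a) ^+ m) n - ((1 - x) ^+ m) n]|)) => [a|a|].
- exact: projective_norm_ge0.
- rewrite /tinv -sumrB; apply: le_trans (projective_norm_sum _ _ _) _.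
  by apply: ler_sum => m _; rewrite !texpE.
- by apply: cvg0_sum => m; apply: tcvgX.
Qed.

End Convergence.

Section RoughFamily.
Context {R : realType} {k : scalar_kind} {V : finNormedModType (scalars R k)}.
Local Notation "`|[ a ]|" := (@projective_norm R k V _ a) (at level 0, a at level 99).
Implicit Types (S X Y : R -> R -> tseries V) (T p q : R).

(** This gathers multiplicative functionals of all degrees. Finite variation is expressed by a
    control at each level, a form that passes easily through gluing, reversal and change of
    exponent; [rough_family_mf] and [mf_rough_family] translate back and forth. *)
Record rough_family T p S : Prop := {
  rf_one : forall s t, simplex T (s, t) -> S s t 0 = tone V 0;
  rf_cvg : forall s t, simplex T (s, t) ->
    tcvg (within (simplex T) (nbhs (s, t))) (fun a => S a.1 a.2) (S s t);
  rf_mul : forall s t u, 0 <= s -> s <= t -> t <= u -> u <= T -> S s u = S s t * S t u;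
  rf_control : forall n, (0 < n)%N -> exists w C, [/\ control T w, 0 <= C &
    forall s t, simplex T (s, t) -> `|[S s t n]| <= C * w s t `^ (n%:R / p)]
}.

(** Constant term 1 makes [x] invertible, and an invertible idempotent is 1; this settles the
    increments over a single point. *)
Lemma idempotent_tone (x : tseries V) : x 0 = tone V 0 -> x = x * x -> x = 1.
Proof.
move=> x0 xx; rewrite -[LHS]mul1r -{1}(tinvV x0) -mulrA -xx; exact: tinvV.
Qed.

Lemma rough_family_diag T p S t : rough_family T p S -> 0 <= t -> t <= T -> S t t = 1.
Proof.
move=> hS t0 tT; apply: idempotent_tone; first exact: (rf_one hS).
exact: (rf_mul hS t0 (lexx t) (lexx t) tT).
Qed.

Lemma level_variation_psum T p S i a : 
  [set (\sum_(0 <= l < size s) projective_norm (S (nth T (0 :: s) l) (nth T (0 :: s) l.+1) i)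
        `^ (p / i%:R))%:E | s in itv_partition 0 T] a <->
  [set (psum (fun s t => `|[S s t i]| `^ (p / i%:R)) 0 s)%:E | s in itv_partition 0 T] a.
Proof.
by split=> -[s hs <-]; exists s => //; rewrite -(psumE (fun s t => `|[S s t i]| `^ (p / i%:R)) T).
Qed.

Lemma rough_family_control T p S N : 0 < p -> 0 <= T -> rough_family T p S ->
  exists2 w, control T w & forall n s t, (n <= N)%N -> simplex T (s, t) ->
    `|[S s t n]| <= w s t `^ (n%:R / p).
Proof.
move=> p0 T0 hS; elim: N => [|N [w cw hw]].
  (* The zero control suffices in degree 0, where the exponent is 0 and the power is 1. *)
  exists (fun _ _ => 0); first by split=> // *; rewrite addr0.
  move=> n s t; rewrite leqn0 => /eqP -> st.
  by rewrite mul0r powRr0 (rf_one hS st) projective_norm_tone0.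
have [w' [C [cw' C0 hw']]] := rf_control hS (ltn0Sn N).
(* Scaling the control of level [N.+1] by [c] absorbs its constant [C]; adding controls then serves
   all levels at once. *)
pose c := C `^ (p / N.+1%:R).
have c0 : 0 <= c by exact: powR_ge0.
have N0 : 0 < N.+1%:R :> R by rewrite ltr0n.
exists (fun s t => w s t + c * w' s t); first by apply: controlD => //; exact: controlZ.
move=> n s t nN [/= s0 st tT].
have w0 := cw.1 s t s0 st tT; have w'0 := cw'.1 s t s0 st tT.
move: nN; rewrite leq_eqVlt => /orP[/eqP ->|nN]; last first.
  apply: le_trans (hw n s t nN _) _ => //; apply: ge0_ler_powR.
  - by rewrite divr_ge0 // ltW.
  - by rewrite nnegrE.
  - by rewrite nnegrE addr_ge0 // mulr_ge0.
  - by rewrite lerDl mulr_ge0.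
apply: le_trans (hw' s t _) _ => //.
have -> : C = c `^ (N.+1%:R / p).
  by rewrite /c -powRrM mulrA divfK ?gt_eqF // divff ?gt_eqF // powRr1.
rewrite -powRM //; apply: ge0_ler_powR.
- by rewrite divr_ge0 // ltW.
- by rewrite nnegrE mulr_ge0.
- by rewrite nnegrE addr_ge0 // mulr_ge0.
- by rewrite lerDr.
Qed.

Lemma powR_div_cancel (x p : R) n : 0 < p -> (0 < n)%N -> 0 <= x ->
  (x `^ (n%:R / p)) `^ (p / n%:R) = x.
Proof.
move=> p0 n0 x0; have n0' : 0 < n%:R :> R by rewrite ltr0n.
by rewrite -powRrM mulrA divfK ?gt_eqF // divff ?gt_eqF // powRr1.
Qed.

Lemma powR_div_cancelV (x p : R) n : 0 < p -> (0 < n)%N -> 0 <= x ->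
  (x `^ (p / n%:R)) `^ (n%:R / p) = x.
Proof.
move=> p0 n0 x0; have n0' : 0 < n%:R :> R by rewrite ltr0n.
by rewrite -powRrM mulrA divfK ?gt_eqF // divff ?gt_eqF // powRr1.
Qed.

Lemma le_powR_div (a x p : R) n : 0 < p -> (0 < n)%N -> 0 <= x -> 0 <= a ->
  (a <= x `^ (n%:R / p)) = (a `^ (p / n%:R) <= x).
Proof.
move=> p0 n0 x0 a0; have n0' : 0 < n%:R :> R by rewrite ltr0n.
apply/idP/idP => h.
  rewrite -[leRHS](powR_div_cancel p0 n0 x0).
  by apply: ge0_ler_powR; rewrite ?nnegrE ?powR_ge0 // divr_ge0 // ltW.
rewrite -[leLHS](powR_div_cancelV p0 n0 a0).
by apply: ge0_ler_powR; rewrite ?nnegrE ?powR_ge0 // divr_ge0 // ltW.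
Qed.

Lemma rough_family_mf T p S N : 0 < p -> 0 <= T -> rough_family T p S ->
  multiplicative_functional T p N S.
Proof.
move=> p0 T0 hS; split.
- exact: (rf_one hS).
- by move=> n s t _ st; exact: (rf_cvg hS).
- by move=> n s t u _ s0 st tu uT; rewrite (rf_mul hS s0 st tu uT).
- have [w cw hw] := rough_family_control N p0 T0 hS.
  apply: (@le_lt_trans _ _ (\sum_(1 <= i < N.+1) (w 0 T)%:E)%E); last by rewrite sumEFin ltry.
  rewrite big_nat_cond [leRHS]big_nat_cond; apply: lee_sum => i /andP[/andP[i0 iN] _].
  apply: ge_ereal_sup => _ /level_variation_psum[s hs <-]; rewrite lee_fin.
  apply: (psum_control cw _ _ _ hs) => // a b a0 ab bT.
  rewrite -le_powR_div ?projective_norm_ge0 ?cw.1 ?(ltW ab) //.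
  by apply: hw => //; split => //=; exact: ltW.
Qed.

Lemma mf_rough_family T p S : 0 < p -> 0 <= T ->
  (forall N, multiplicative_functional T p N S) -> rough_family T p S.
Proof.
move=> p0 T0 hS; split.
- exact: (mf_one (hS 0)).
- by move=> s t st n; exact: (mf_continuous (hS n)).
- move=> s t u s0 st tu uT; apply: functional_extensionality_dep => n.
  exact: (mf_multiplicative (hS n)).
- move=> n n0; pose F s t := `|[S s t n]| `^ (p / n%:R).
  have F0 s t : 0 <= F s t by exact: powR_ge0.
  have V_ge0 i : (0 <= level_variation T p S i)%E.
    have [s hs] := itv_partition_ex T0.
    apply: le_trans (_ : (psum (fun s t => `|[S s t i]| `^ (p / i%:R)) 0 s)%:E <= _)%E.
      by rewrite lee_fin psum_ge0 // => *; exact: powR_ge0.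
    by apply: ereal_sup_ubound; apply/level_variation_psum; exists s.
  have Vfin : level_variation T p S n \is a fin_num.
    rewrite ge0_fin_numE //; apply: le_lt_trans (mf_variation (hS n)).
    by rewrite big_nat_recr //= leeDr // sume_ge0.
  have FC s : itv_partition 0 T s -> psum F 0 s <= fine (level_variation T p S n).
    move=> hs; rewrite -lee_fin fineK //; apply: ereal_sup_ubound.
    by apply/level_variation_psum; exists s.
  have cF := pvar_control F0 FC.
  (* The variation of level n is its own control. It vanishes on a degenerate interval, where
     [S s s = 1] must be invoked. *)
  exists (pvar F), 1; split => // s t [/= s0 st tT]; rewrite mul1r.
  rewrite le_powR_div ?projective_norm_ge0 ?cF.1 //.
  move: st; rewrite le_eqVlt => /orP[/eqP e|st]; last exact: (pvar_ge1 F0 FC).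
  rewrite -e pvarxx; have -> : `|[S s s n]| = 0; last first.
    by rewrite powR0 // mulf_neq0 ?invr_neq0 ?gt_eqF // ltr0n.
  have e0 : S s s 0 = tone V 0 by apply: (mf_one (hS 0)); split => //=; rewrite e.
  have -> : S s s = 1.
    rewrite -e in tT; apply: idempotent_tone => //; apply: functional_extensionality_dep => m.
    exact: (mf_multiplicative (hS m)).
  by rewrite tone_degree // projective_norm0.
Qed.

End RoughFamily.

(** * Change of exponent, gluing and time reversal *)

Section FamilyOperations.
Context {R : realType} {k : scalar_kind} {V : finNormedModType (scalars R k)}.
Local Notation "`|[ a ]|" := (@projective_norm R k V _ a) (at level 0, a at level 99).
Implicit Types (S X Y : R -> R -> tseries V) (T p q : R).

Lemma tcvg_comp T T' S (f g : R * R -> R) (a : R * R) x :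
  f b @[b --> a] --> f a -> g b @[b --> a] --> g a ->
  (forall b, simplex T' b -> simplex T (f b, g b)) ->
  tcvg (within (simplex T) (nbhs (f a, g a))) (fun b => S b.1 b.2) x ->
  tcvg (within (simplex T') (nbhs a)) (fun b => S (f b) (g b)) x.
Proof.
move=> hf hg hT hS n.
apply: (@cvg_comp _ _ _ (fun b => (f b, g b)) (fun b => `|[S b.1 b.2 n - x n]|) _ _ _ _ (hS n)).
have hfg : (f b, g b) @[b --> a] --> nbhs (f a, g a) by exact: cvg_pair hf hg.
move=> P /hfg hP; suff : nbhs a (fun b => simplex T' b -> P (f b, g b)) by [].
have {}hP : nbhs a (fun b => simplex T (f b, g b) -> P (f b, g b)) by [].
by apply: filterS hP => b hb Tb; apply: hb; exact: hT.
Qed.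

Lemma min_continuous T : continuous (fun x : R => Num.min x T).
Proof.
apply: (@lipschitz_fun_continuous R R^o _ 1) => x y; rewrite mulr1.
have h3 := ler_norm (x - y); have := ler_norm (y - x); rewrite distrC => h1.
have n0 := normr_ge0 (x - y).
by rewrite ler_norml; case: (leP x T) => xT; case: (leP y T) => yT; apply/andP; split; lra.
Qed.

Lemma max_sub_continuous T : continuous (fun x : R => Num.max 0 (x - T)).
Proof.
apply: (@lipschitz_fun_continuous R R^o _ 1) => x y; rewrite mulr1.
have h3 := ler_norm (x - y); have := ler_norm (y - x); rewrite distrC => h1.
have n0 := normr_ge0 (x - y).
by rewrite ler_norml; case: (leP 0 (x - T)) => xT; case: (leP 0 (y - T)) => yT; apply/andP; split; lra.
Qed.

Lemma rough_family_exponent T p q S : 0 < p -> p <= q ->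
  rough_family T p S -> rough_family T q S.
Proof.
move=> p0 pq [h1 h2 h3 h4]; split=> // n n0.
have [w [C [cw C0 hw]]] := h4 n n0.
have n0' : 0 < n%:R :> R by rewrite ltr0n.
have q0 : 0 < q by apply: lt_le_trans pq.
(* The surplus power of [w s t], nonnegative because p <= q, is bounded by that of [w 0 T]. *)
exists w, (C * w 0 T `^ (n%:R / p - n%:R / q)); split => //.
  by rewrite mulr_ge0 // powR_ge0.
move=> s t st; apply: le_trans (hw s t st) _; rewrite -mulrA ler_wpM2l //.
case: st => /= s0 st tT.
have w0 := cw.1 s t s0 st tT.
have [->|wn0] := eqVneq (w s t) 0.
  rewrite powR0 ?mulr_ge0 ?powR_ge0 // mulf_neq0 ?invr_neq0 ?gt_eqF //.
rewrite -{1}[n%:R / p](subrK (n%:R / q)) powRD ?wn0 ?implybT //.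
rewrite ler_wpM2r ?powR_ge0 //; apply: ge0_ler_powR.
- by rewrite subr_ge0 ler_pM2l // lef_pV2 // posrE.
- by rewrite nnegrE.
- by rewrite nnegrE cw.1 // ?(le_trans st) // (le_trans s0) // (le_trans st).
- exact: (control_le cw).
Qed.

Lemma rough_family_one T p : rough_family T p (fun _ _ => tone V).
Proof.
split=> //.
- by move=> s t _; exact: tcvg_cst.
- by move=> *; rewrite mulr1.
- move=> n n0; exists (fun _ _ => 0), 0.
  have c0 : control T (fun _ _ => 0) by split=> // *; rewrite addr0.
  split=> // s t _; rewrite mul0r -[tone V n]/((1 : tseries V) n).
  by rewrite tone_degree // projective_norm0.
Qed.

(** Bounds homogeneous in the degree survive a product: the weights of every term combine to at most
    c^(n/p), and there are at most [N.+1] terms. *)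
Lemma projective_norm_mul_weighted (N : nat) (A B a b c p : R) (x y : tseries V) n :
  0 < p -> 0 <= A -> 0 <= B -> 0 <= a -> 0 <= b -> a <= c -> b <= c -> (n <= N)%N ->
  (forall m, (m <= n)%N -> `|[x m]| <= A * a `^ (m%:R / p)) ->
  (forall m, (m <= n)%N -> `|[y m]| <= B * b `^ (m%:R / p)) ->
  `|[(x * y) n]| <= N.+1%:R * (A * B) * c `^ (n%:R / p).
Proof.
move=> p0 A0 B0 a0 b0 ac bc nN hx hy.
have c0 : 0 <= c by apply: le_trans ac.
apply: le_trans (projective_norm_mul _ _ _) _.
apply: (@le_trans _ _ (\sum_(j < n.+1) A * B * c `^ (n%:R / p))); last first.
  rewrite sumr_const card_ord -[leLHS]mulr_natl mulrA ler_wpM2r ?powR_ge0 //.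
  by rewrite ler_wpM2r ?mulr_ge0 // ler_nat.
apply: ler_sum => j _; have jn : (j <= n)%N by rewrite -ltnS.
apply: le_trans (ler_pM (projective_norm_ge0 _) (projective_norm_ge0 _) (hx _ jn) (hy _ (leq_subr j n))) _.
rewrite mulrACA ler_wpM2l ?mulr_ge0 //.
have mono x' m : 0 <= x' -> x' <= c -> x' `^ (m%:R / p) <= c `^ (m%:R / p).
  by move=> x0 xc; apply: ge0_ler_powR; rewrite ?nnegrE // divr_ge0 // ltW.
apply: le_trans (ler_pM (powR_ge0 _ _) (powR_ge0 _ _) (mono a j a0 ac) (mono b _ b0 bc)) _.
have [->|j0] := posnP j; first by rewrite mul0r powRr0 mul1r subn0.
have n0 : (0 < n)%N by apply: leq_trans jn.
rewrite -powRD -?mulrDl -?natrD ?subnKC //.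
by rewrite mulf_eq0 invr_eq0 (gt_eqF p0) orbF pnatr_eq0 (gtn_eqF n0).
Qed.

(** Clamping the times yields one formula for the three cases of [concat]: a factor whose interval
    collapses to a point is 1. Continuity then comes from that of [min] and [max]. *)
Definition glue T Y X : R -> R -> tseries V := fun s t =>
  Y (Num.min s T) (Num.min t T) * X (Num.max 0 (s - T)) (Num.max 0 (t - T)).

Lemma glue_simplexl T T' s t : 0 <= T -> simplex (T + T') (s, t) ->
  simplex T (Num.min s T, Num.min t T).
Proof.
move=> T0 [/= s0 st tT]; split => /=; first by rewrite le_min s0.
  by rewrite le_min2.
by rewrite ge_min lexx orbT.
Qed.

Lemma glue_simplexr T T' s t : 0 <= T' -> simplex (T + T') (s, t) ->
  simplex T' (Num.max 0 (s - T), Num.max 0 (t - T)).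
Proof.
move=> T0 [/= s0 st tT]; split => /=; first by rewrite le_max lexx.
  by rewrite ge_max !le_max lexx /= lerB // orbT.
by rewrite ge_max T0 lerBlDl.
Qed.

Lemma glue_lel T p T' Y X s t : 0 <= T -> 0 <= T' -> rough_family T' p X ->
  s <= t -> t <= T -> glue T Y X s t = Y s t.
Proof.
move=> T0 T'0 hX st tT; rewrite /glue min_l ?(le_trans st) // min_l //.
rewrite !max_l ?subr_le0 // ?(le_trans st) //.
by rewrite (rough_family_diag hX) // mulr1.
Qed.

Lemma glue_ger T p Y X s t : 0 <= T -> rough_family T p Y ->
  T <= s -> s <= t -> glue T Y X s t = X (s - T) (t - T).
Proof.
move=> T0 hY Ts st; rewrite /glue !min_r // ?(le_trans Ts) //.
rewrite !max_r ?subr_ge0 // ?(le_trans Ts) //.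
by rewrite (rough_family_diag hY) // mul1r.
Qed.

Lemma rough_family_glue T T' p Y X : 0 < p -> 0 <= T -> 0 <= T' ->
  rough_family T p Y -> rough_family T' p X -> rough_family (T + T') p (glue T Y X).
Proof.
move=> p0 T0 T'0 hY hX; split.
- move=> s t st; apply: tmul_degree0.
    exact: (rf_one hY (glue_simplexl T0 st)).
  exact: (rf_one hX (glue_simplexr T'0 st)).
- move=> s t st; apply: tcvgM.
    apply: (@tcvg_comp T (T + T') Y (fun a => Num.min a.1 T) (fun a => Num.min a.2 T) (s, t)) => /=.
    + by apply: (cvg_comp fst (fun x => Num.min x T)); [exact: cvg_fst|exact: min_continuous].
    + by apply: (cvg_comp snd (fun x => Num.min x T)); [exact: cvg_snd|exact: min_continuous].
    + by move=> [a b]; exact: (glue_simplexl T0).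
    + exact: (rf_cvg hY (glue_simplexl T0 st)).
  apply: (@tcvg_comp T' (T + T') X (fun a => Num.max 0 (a.1 - T))
    (fun a => Num.max 0 (a.2 - T)) (s, t)) => /=.
  + by apply: (cvg_comp fst (fun x => Num.max 0 (x - T))); [exact: cvg_fst|exact: max_sub_continuous].
  + by apply: (cvg_comp snd (fun x => Num.max 0 (x - T))); [exact: cvg_snd|exact: max_sub_continuous].
  + by move=> [a b]; exact: (glue_simplexr T'0).
  + exact: (rf_cvg hX (glue_simplexr T'0 st)).
- move=> s t u s0 st tu uT.
  (* If t <= T, only the [Y] factor is cut at [t]; otherwise only the [X] factor is. *)
  have [tT|Tt] := leP t T.
    rewrite (glue_lel _ T0 T'0 hX st tT) /glue [Num.min s T]min_l ?(le_trans st) //.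
    rewrite [Num.min t T]min_l // [Num.max 0 (s - T)]max_l ?subr_le0 ?(le_trans st) //.
    rewrite [Num.max 0 (t - T)]max_l ?subr_le0 // mulrA.
    congr (_ * _); apply: (rf_mul hY) => //; first by rewrite le_min tu.
    by rewrite ge_min lexx orbT.
  have Tt' := ltW Tt.
  rewrite (glue_ger X T0 hY Tt' tu) /glue [Num.min u T]min_r ?(le_trans Tt') // [Num.min t T]min_r //.
  rewrite -mulrA; congr (_ * _).
  rewrite [Num.max 0 (t - T)]max_r ?subr_ge0 // [Num.max 0 (u - T)]max_r ?subr_ge0 ?(le_trans Tt') //.
  apply: (rf_mul hX).
  + by rewrite le_max lexx.
  + by rewrite ge_max subr_ge0 Tt' lerB.
  + by rewrite lerB.
  + by rewrite lerBlDl.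
- move=> n n0.
  have [wY cwY hwY] := rough_family_control n p0 T0 hY.
  have [wX cwX hwX] := rough_family_control n p0 T'0 hX.
  pose w s t := wY (Num.min s T) (Num.min t T) + wX (Num.max 0 (s - T)) (Num.max 0 (t - T)).
  exists w, n.+1%:R; split => //.
    split=> [s t s0 st tT|s t u s0 st tu uT].
      have sT : simplex (T + T') (s, t) by [].
      have [? ? ?] := glue_simplexl T0 sT; have [? ? ?] := glue_simplexr T'0 sT.
      by rewrite addr_ge0 ?cwY.1 ?cwX.1.
    have tT : t <= T + T' by apply: le_trans uT.
    have h1 : simplex (T + T') (s, t) by [].
    have h2 : simplex (T + T') (t, u) by split => //=; apply: le_trans st.
    have [? ? ?] := glue_simplexl T0 h1; have [? ? ?] := glue_simplexr T'0 h1.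
    have [? ? ?] := glue_simplexl T0 h2; have [? ? ?] := glue_simplexr T'0 h2.
    by rewrite /w addrACA lerD ?cwY.2 ?cwX.2.
  move=> s t sT.
  have hs := glue_simplexl T0 sT; have hs' := glue_simplexr T'0 sT.
  have a0 : 0 <= wY (Num.min s T) (Num.min t T) by case: hs => *; exact: cwY.1.
  have b0 : 0 <= wX (Num.max 0 (s - T)) (Num.max 0 (t - T)) by case: hs' => *; exact: cwX.1.
  have -> : n.+1%:R = n.+1%:R * (1 * 1) :> R by rewrite !mulr1.
  apply: (projective_norm_mul_weighted p0 ler01 ler01 a0 b0) => //.
  + by rewrite lerDl.
  + by rewrite lerDr.
  + by move=> m mn; rewrite mul1r; exact: hwY.
  + by move=> m mn; rewrite mul1r; exact: hwX.
Qed.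

Definition time_reversal T S : R -> R -> tseries V := fun s t => tinv (S (T - t) (T - s)).

Lemma reversal_simplex T s t : simplex T (s, t) -> simplex T (T - t, T - s).
Proof. by move=> [/= s0 st tT]; split => /=; rewrite ?subr_ge0 ?lerB // gerBl. Qed.

Lemma rough_family_reversal T p S : 0 < p -> 0 <= T ->
  rough_family T p S -> rough_family T p (time_reversal T S).
Proof.
move=> p0 T0 hS; split.
- by move=> s t st; exact: tinv_degree0.
- move=> s t st; apply: tcvg_inv.
  apply: (@tcvg_comp T T S (fun a => T - a.2) (fun a => T - a.1) (s, t)) => /=.
  + by apply: cvgB; [exact: cvg_cst|exact: cvg_snd].
  + by apply: cvgB; [exact: cvg_cst|exact: cvg_fst].
  + by move=> [a b]; exact: reversal_simplex.
  + exact: (rf_cvg hS (reversal_simplex st)).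
- move=> s t u s0 st tu uT; rewrite /time_reversal.
  have tT : t <= T by apply: le_trans uT.
  have t0 : 0 <= t by apply: le_trans st.
  rewrite (@rf_mul _ _ _ _ _ _ hS _ (T - t)) ?subr_ge0 ?lerB ?gerBl //.
  rewrite tinvM //; apply: (rf_one hS); exact: reversal_simplex.
- move=> n n0; have [w cw hw] := rough_family_control n p0 T0 hS.
  (* Each factor [1 - x] contributes 2 and each product at most [n.+1] terms. *)
  pose D m : R := (n.+1%:R * 2) ^+ m.
  exists (fun s t => w (T - t) (T - s)), (\sum_(0 <= m < n.+1) D m); split.
  + split=> [s t s0 st tT|s t u s0 st tu uT].
      by apply: cw.1; rewrite ?subr_ge0 ?lerB // gerBl.
    by rewrite addrC; apply: cw.2; rewrite ?subr_ge0 ?lerB ?gerBl.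
  + by apply: sumr_ge0 => m _; rewrite exprn_ge0 // mulr_ge0.
  + move=> s t st; rewrite /time_reversal /tinv mulr_suml.
    apply: le_trans (projective_norm_sum _ _ _) _; apply: ler_sum => m _; rewrite texpE.
    have [s0' st' tT'] := reversal_simplex st.
    set x := S _ _; set b := w _ _.
    have b0 : 0 <= b by exact: cw.1.
    have one_le i : `|[(1 : tseries V) i]| <= 1 * b `^ (i%:R / p).
      rewrite mul1r; case: i => [|i]; first by rewrite projective_norm_tone0 mul0r powRr0.
      by rewrite tone_degree // projective_norm0 powR_ge0.
    have h2 i : (i <= n)%N -> `|[(1 - x) i]| <= 2 * b `^ (i%:R / p).
      move=> ni; apply: le_trans (projective_normD _ _) _.
      rewrite -[2]/(1 + 1) mulrDl lerD // mul1r.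
      rewrite -[X in `|[X]|]/(- x i) projective_normN.
      by apply: hw => //; exact: reversal_simplex.
    suff h i : (i <= n)%N -> `|[((1 - x) ^+ m) i]| <= D m * b `^ (i%:R / p) by exact: h.
    elim: m i => [|m IH] i ni; first by rewrite /D !expr0; exact: one_le.
    rewrite exprS (_ : D m.+1 = n.+1%:R * (2 * D m)); last by rewrite /D exprS mulrA.
    apply: (@projective_norm_mul_weighted n 2 (D m) b b b) => //.
    * by rewrite exprn_ge0 // mulr_ge0.
    * by move=> j ji; apply: h2; exact: leq_trans ni.
    * by move=> j ji; apply: IH; exact: leq_trans ni.
Qed.

End FamilyOperations.

(** * Decay and uniqueness *)

Section SumInverseSquares.
Context {R : realType}.

Lemma sum_inv_sq_le n : \sum_(1 <= i < n.+2) (i%:R ^- 2 : R) <= 2 - n.+1%:R^-1.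
Proof.
elim: n => [|n IH]; first by rewrite big_nat1 expr1n invr1; lra.
rewrite big_nat_recr //=; apply: le_trans (lerD IH (lexx _)) _.
have n0 : 0 < n.+1%:R :> R by rewrite ltr0n.
have -> : n.+2%:R = n.+1%:R + 1 :> R by rewrite -natr1.
move: (n.+1%:R : R) n0 => a a0.
rewrite -subr_ge0 (_ : _ - _ = (a * (a + 1) ^+ 2)^-1).
  by rewrite invr_ge0 mulr_ge0 ?exprn_ge0 ?addr_ge0 ?(ltW a0).
by field; rewrite gt_eqF ?gt_eqF // ltr_pwDr // ltW.
Qed.

(** For i + j = n, (i + j)^2 <= 2 (i^2 + j^2) gives 1/(i^2 j^2) <= (2/n^2) (1/i^2 + 1/j^2). Each of
    the two sums is at most 2, whence 8. *)
Lemma sum_inv_sq_convolution_le n : (0 < n)%N ->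
  \sum_(1 <= i < n) ((i%:R ^- 2) * ((n - i)%N%:R ^- 2) : R) <= 8 / n%:R ^+ 2.
Proof.
case: n => // n _; have n0 : 0 < n.+1%:R :> R by rewrite ltr0n.
have bound2 : \sum_(1 <= i < n.+1) (i%:R ^- 2 : R) <= 2.
  case: n n0 => [|n] _; first by rewrite big_geq.
  by apply: le_trans (sum_inv_sq_le n) _; rewrite gerBl invr_ge0.
apply: (@le_trans _ _ (\sum_(1 <= i < n.+1) 2 / n.+1%:R ^+ 2 * (i%:R ^- 2 + (n.+1 - i)%N%:R ^- 2))).
  rewrite big_nat_cond [leRHS]big_nat_cond; apply: ler_sum => i /andP[/andP[i0 iN] _].
  have a0 : 0 < i%:R :> R by rewrite ltr0n.
  have b0 : 0 < (n.+1 - i)%N%:R :> R by rewrite ltr0n subn_gt0.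
  have -> : n.+1%:R = i%:R + (n.+1 - i)%N%:R :> R by rewrite -natrD subnKC // ltnW.
  move: (i%:R : R) ((n.+1 - i)%N%:R : R) a0 b0 => a b a0 b0.
  rewrite -subr_ge0 (_ : _ - _ = ((a - b) / ((a + b) * a * b)) ^+ 2).
    by rewrite sqr_ge0.
  by field; rewrite !gt_eqF ?addr_gt0.
rewrite -mulr_sumr big_split /=.
have -> : \sum_(1 <= i < n.+1) ((n.+1 - i)%N%:R ^- 2 : R) = \sum_(1 <= i < n.+1) (i%:R ^- 2 : R).
  by rewrite [RHS]big_nat_rev /=; apply: eq_big_nat => i _; rewrite add1n subSS.
have h : 0 <= 2 / n.+1%:R ^+ 2 :> R by rewrite divr_ge0 // exprn_ge0 // ltW.
apply: le_trans (ler_wpM2l h (lerD bound2 bound2)) _.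
by rewrite mulrAC ler_wpM2r ?invr_ge0 ?exprn_ge0 ?(ltW n0) //; lra.
Qed.

End SumInverseSquares.

(** * Uniqueness and decay of the levels *)

Section RoughEstimates.
Context {R : realType} {k : scalar_kind} {V : finNormedModType (scalars R k)}.
Local Notation "`|[ a ]|" := (@projective_norm R k V _ a) (at level 0, a at level 99).
Implicit Types (S : R -> R -> tseries V) (T p : R).

(** The power p / i makes every level scale like a control; the shifted index leaves out degree 0,
    which is constant. *)
Definition level_sum S p N s t : R :=
  \sum_(0 <= i < N) `|[S s t i.+1]| `^ (p / i.+1%:R).

Lemma level_sum_ge0 S p N s t : 0 <= level_sum S p N s t.
Proof. by apply: sumr_ge0 => i _; exact: powR_ge0. Qed.

Lemma level_sum_ge S p N s t n : 0 < p -> (0 < n)%N -> (n <= N)%N ->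
  `|[S s t n]| <= level_sum S p N s t `^ (n%:R / p).
Proof.
move=> p0; case: n => // n _ nN.
rewrite le_powR_div ?projective_norm_ge0 ?level_sum_ge0 //.
rewrite /level_sum (bigD1_seq n) ?mem_index_iota ?iota_uniq //=.
by rewrite lerDl; apply: sumr_ge0 => i _; exact: powR_ge0.
Qed.

Lemma level_sum_diag T p S N s : 0 < p -> rough_family T p S -> 0 <= s -> s <= T ->
  level_sum S p N s s = 0.
Proof.
move=> p0 hS s0 sT; rewrite /level_sum big1 // => i _.
rewrite (rough_family_diag hS) // tone_degree // projective_norm0 powR0 //.
by rewrite mulf_neq0 ?invr_neq0 ?gt_eqF // ltr0n.
Qed.

Lemma level_sum_bounded T p S N : 0 < p -> 0 <= T -> rough_family T p S ->
  exists C, forall q, itv_partition 0 T q -> psum (level_sum S p N) 0 q <= C.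
Proof.
move=> p0 T0 hS; have [w cw hw] := rough_family_control N p0 T0 hS.
exists (N%:R * w 0 T) => q hq.
apply: (@psum_control _ T _ (fun s t => N%:R * w s t)) => // [|s t s0 st tT].
  exact: controlZ.
have -> : N%:R * w s t = \sum_(0 <= i < N) w s t by rewrite sumr_const_nat subn0 mulr_natl.
rewrite /level_sum big_nat_cond [leRHS]big_nat_cond.
apply: ler_sum => i /andP[/andP[_ iN] _].
have st' : simplex T (s, t) by split => //=; exact: ltW.
by rewrite -le_powR_div ?projective_norm_ge0 ?hw ?cw.1 // ltW.
Qed.

Lemma level_sum_lsc T p S N : 0 < p -> rough_family T p S ->
  endpoint_lsc T (level_sum S p N).
Proof.
move=> p0 hS; apply: endpoint_lsc_sum => i.
have q0 : 0 < p / i.+1%:R by rewrite divr_gt0.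
have near_st s t d : simplex T (s, t) -> 0 < d -> exists2 r : R, 0 < r &
    forall u v, simplex T (u, v) -> `|s - u| < r -> `|t - v| < r ->
    `|[S s t i.+1]| <= `|[S u v i.+1]| + d.
  move=> st d0; have /cvgrPdist_lt/(_ d d0) := rf_cvg hS st i.+1.
  move=> /nbhs_ballP[r r0 hr]; exists r => // u v uv su tv.
  have h := hr (u, v) (conj su tv) uv; rewrite sub0r normrN in h.
  have h' : `|[S u v i.+1 - S s t i.+1]| <= d.
    by apply: ltW; apply: le_lt_trans h; exact: ler_norm.
  rewrite -[S s t i.+1](subrK (S u v i.+1)) addrC; apply: le_trans (projective_normD _ _) _.
  by rewrite lerD2l projective_normB.
split=> s t e s0 st tT e0.
  have [d d0 hd] := powR_lsc (projective_norm_ge0 (S s t i.+1)) q0 e0.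
  have [|r r0 hr] := near_st s t d _ d0; first by split => //=; exact: ltW.
  exists r => // u su ut ur; apply: hd; first exact: projective_norm_ge0.
  apply: hr; rewrite ?subrr ?normr0 ?gtr0_norm ?subr_gt0 //.
  by split => //=; [exact: ltW|apply: le_trans tT; exact: ltW].
have [d d0 hd] := powR_lsc (projective_norm_ge0 (S s t i.+1)) q0 e0.
have [|r r0 hr] := near_st s t d _ d0; first by split => //=; exact: ltW.
exists r => // u su ut ur; apply: hd; first exact: projective_norm_ge0.
apply: hr; rewrite ?subrr ?normr0 ?ltr0_norm ?subr_lt0 ?opprB //.
by split => //=; [apply: le_trans s0 _; exact: ltW|exact: ltW].
Qed.

Lemma pvar_ge_diag T C (F : R -> R -> R) s t : (forall s t, 0 <= F s t) ->
  (forall q, itv_partition 0 T q -> psum F 0 q <= C) ->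
  (forall s, 0 <= s -> s <= T -> F s s = 0) ->
  simplex T (s, t) -> F s t <= pvar F s t.
Proof.
move=> F0 FC Fd [/= s0 + tT]; rewrite le_eqVlt => /orP[/eqP e|st].
  by rewrite -e pvarxx Fd // e.
exact: (pvar_ge1 F0 FC).
Qed.

(** In the first degree n not yet compared, the difference of the families is additive over
    intervals, since the lower degrees agree. It is also O(w^(n/p)) with n / p > 1, which forces it
    to vanish. *)
Lemma rough_family_unique T p S S' : 0 < p -> 0 <= T ->
  rough_family T p S -> rough_family T p S' ->
  (forall n s t, (n <= Num.truncn p)%N -> simplex T (s, t) -> S s t n = S' s t n) ->
  forall s t, simplex T (s, t) -> S s t = S' s t.
Proof.
move=> p0 T0 hS hS' low s t st; apply: functional_extensionality_dep => n.
elim/ltn_ind: n s t st => n IH s t st.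
have [np|pn] := leqP n (Num.truncn p); first exact: low.
have n0 : (0 < n)%N by apply: leq_ltn_trans pn.
have pn' : p < n%:R by rewrite -truncn_lt_nat // ltW.
have [C hC] := level_sum_bounded n p0 T0 hS.
have [C' hC'] := level_sum_bounded n p0 T0 hS'.
(* Both families up to level n enter the control, which yields the presupposed bound with constant
   2. *)
pose F s t := level_sum S p n s t + level_sum S' p n s t.
have F0 a b : 0 <= F a b by rewrite addr_ge0 ?level_sum_ge0.
have FC q : itv_partition 0 T q -> psum F 0 q <= C + C'.
  by move=> hq; rewrite psumD; apply: lerD; [exact: hC|exact: hC'].
have Fd a : 0 <= a -> a <= T -> F a a = 0.
  by move=> a0 aT; rewrite /F !(@level_sum_diag T) // addr0.
have Flsc : endpoint_lsc T F by apply: endpoint_lscD; exact: level_sum_lsc.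
have cw := pvar_control F0 FC.
have hw := pvar_halving F0 FC Flsc.
have le_w a b : simplex T (a, b) -> F a b <= pvar F a b by exact: (pvar_ge_diag F0 FC Fd).
have th0 : 0 <= n%:R / p by rewrite divr_ge0 // ltW.
have [s0 st' tT] := st.
(* Exact subadditivity allows [B = 0], and then [B' = 0] is admissible. *)
have := @halving_bound _ T (pvar F) (fun a b => `|[S a b n - S' a b n]|) (n%:R / p) 2 0 0 cw hw.
move=> /(_ _ (lexx _) _ _ _ s t s0 st' tT).
rewrite mul0r => H; apply/eqP; rewrite -subr_eq0; apply/eqP/projective_norm_eq0.
apply: le_anti; rewrite projective_norm_ge0 andbT; apply: H.
- by rewrite ltr_pdivlMr // mul1r.
- by rewrite mulr0 addr0.
- move=> a b a0 ab bT; have ab' : simplex T (a, b) by [].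
  apply: le_trans (projective_normD _ _) _; rewrite projective_normN.
  rewrite -[2]/(1 + 1) mulrDl mul1r; apply: lerD.
    apply: le_trans (level_sum_ge _ _ _ p0 n0 (leqnn n)) _.
    apply: ge0_ler_powR => //; rewrite ?nnegrE ?level_sum_ge0 ?cw.1 //.
    by apply: le_trans (le_w _ _ ab'); rewrite lerDl level_sum_ge0.
  apply: le_trans (level_sum_ge _ _ _ p0 n0 (leqnn n)) _.
  apply: ge0_ler_powR => //; rewrite ?nnegrE ?level_sum_ge0 ?cw.1 //.
  by apply: le_trans (le_w _ _ ab'); rewrite lerDr level_sum_ge0.
- move=> a m b x a0 am mb bT _ _ _; rewrite mul0r addr0.
  rewrite (rf_mul hS a0 am mb bT) (rf_mul hS' a0 am mb bT).
  have am' : simplex T (a, m) by split => //=; apply: le_trans bT.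
  have mb' : simplex T (m, b) by split => //=; apply: le_trans am.
  set x1 := S a m; set y1 := S m b; set x2 := S' a m; set y2 := S' m b.
  have dx i : (i < n)%N -> (x1 - x2) i = 0.
    by move=> lt_in; rewrite -[LHS]/(x1 i - x2 i) (IH i lt_in _ _ am' : x1 i = x2 i) subrr.
  have dy i : (i < n)%N -> (y1 - y2) i = 0.
    by move=> lt_in; rewrite -[LHS]/(y1 i - y2 i) (IH i lt_in _ _ mb' : y1 i = y2 i) subrr.
  have u1 i : (i < 1)%N -> (y1 - 1) i = 0.
    by case: i => // _; rewrite -[LHS]/(y1 0 - tone V 0) (rf_one hS mb' : y1 0 = _) subrr.
  have u2 i : (i < 1)%N -> (x2 - 1) i = 0.
    by case: i => // _; rewrite -[LHS]/(x2 0 - tone V 0) (rf_one hS' am' : x2 0 = _) subrr.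
  have -> : (x1 * y1) n - (x2 * y2) n = (x1 n - x2 n) + (y1 n - y2 n).
    transitivity (((x1 - x2) * (y1 - 1) + (x1 - x2) + ((x2 - 1) * (y1 - y2) + (y1 - y2))) n).
      rewrite -[LHS]/((x1 * y1 - x2 * y2) n); congr (_ n).
      rewrite -{2}[x1 - x2]mulr1 -mulrDr subrK -{2}[y1 - y2]mul1r -mulrDl subrK.
      by rewrite mulrBl mulrBr addrA subrK.
    rewrite -[LHS]/((((x1 - x2) * (y1 - 1)) n + (x1 - x2) n) + (((x2 - 1) * (y1 - y2)) n + (y1 - y2) n)).
    (* One factor starts in degree n, the other in degree 1, so neither cross term reaches degree
       n. *)
    rewrite (tmul_low dx u1) ?addn1 // (tmul_low u2 dy) ?add1n // !add0r.
    by [].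
  exact: projective_normD.
Qed.

Lemma projective_norm_mul_unital (x y : tseries V) n : (0 < n)%N ->
  x 0 = tone V 0 -> y 0 = tone V 0 ->
  `|[(x * y) n]| <= `|[x n]| + `|[y n]| + \sum_(1 <= j < n) `|[x j]| * `|[y (n - j)%N]|.
Proof.
move=> n0 x0 y0; apply: le_trans (projective_norm_mul _ _ _) _.
rewrite -(big_mkord predT (fun j => `|[x j]| * `|[y (n - j)%N]|)) big_nat_recr //= big_ltn //.
rewrite subn0 subnn x0 y0 !projective_norm_tone0 mul1r mulr1; lra.
Qed.

Lemma powR_half (x th : R) : 0 <= x -> (x / 2) `^ th = 2 `^ (- th) * x `^ th.
Proof.
move=> x0; rewrite powRM // mulrC; congr (_ * _).
by rewrite -[in LHS]powR_inv1 // -powRrM mulN1r.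
Qed.

(** The inner terms of the product formula have lower degree, and their convolution costs 8 c^2 b^n
    / n^2 times (w/2)^(n/p). Halving closes when 2^(-n/p) (8 c + 2) <= 1, which is the condition on
    [c]; the condition on [c * b] makes the claimed bound dominate the given one in low degrees. The
    a priori [K] does not enter the conclusion. *)
Lemma level_decay T p S w (M : nat) (c b : R) : 0 < p -> rough_family T p S ->
  control T w -> halving T w -> 0 < c -> 1 <= b ->
  8 * c + 2 <= 2 `^ ((Num.truncn p).+1%:R / p) ->
  (Num.truncn p).+1%:R ^+ 2 <= c * b ->
  (forall n s t, (0 < n)%N -> (n <= Num.truncn p)%N -> simplex T (s, t) ->
    `|[S s t n]| <= w s t `^ (n%:R / p)) ->
  (forall n, (0 < n)%N -> (n <= M)%N -> exists K, forall s t, simplex T (s, t) ->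
    `|[S s t n]| <= K * w s t `^ (n%:R / p)) ->
  forall n s t, (0 < n)%N -> (n <= M)%N -> simplex T (s, t) ->
    `|[S s t n]| <= c / n%:R ^+ 2 * b ^+ n * w s t `^ (n%:R / p).
Proof.
move=> p0 hS cw hw c0 b1 hc hb low apriori; elim/ltn_ind => n IH s t n0 nM st.
have b0 : 0 < b by apply: lt_le_trans b1.
have n2 : 0 < n%:R ^+ 2 :> R by rewrite exprn_gt0 // ltr0n.
have [np|pn] := leqP n (Num.truncn p).
  apply: le_trans (low _ _ _ n0 np st) _; rewrite ler_peMl ?powR_ge0 //.
  rewrite mulrAC ler_pdivlMr // mul1r.
  apply: (@le_trans _ _ (c * b)).
    by apply: le_trans hb; rewrite lerXn2r ?nnegrE // ler_nat ltnW.
  by rewrite ler_wpM2l ?(ltW c0) // ler_eXnr.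
have [K hK] := apriori n n0 nM.
have pn' : p < n%:R by rewrite -truncn_lt_nat // ltW.
have [s0 st' tT] := st.
have two : 8 * c + 2 <= 2 `^ (n%:R / p).
  by apply: le_trans hc _; rewrite ler_powR ?ler1n // ler_wpM2r ?invr_ge0 ?(ltW p0) // ler_nat.
have tw : 2 `^ (- (n%:R / p)) * (8 * c + 2) <= 1.
  by rewrite powRN mulrC ler_pdivrMr ?powR_gt0 // mul1r.
pose B := 8 * c ^+ 2 / n%:R ^+ 2 * b ^+ n * 2 `^ (- (n%:R / p)).
pose B' := c / n%:R ^+ 2 * b ^+ n.
apply: (@halving_bound _ T w (fun s t => `|[S s t n]|) _ K B B') => //.
- by rewrite ltr_pdivlMr // mul1r.
- by rewrite /B !mulr_ge0 ?invr_ge0 ?exprn_ge0 ?powR_ge0 // ?(ltW c0) ?(ltW b0) // (ltW n2).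
- have B'0 : 0 <= B' by rewrite /B' !mulr_ge0 ?invr_ge0 ?exprn_ge0 // ?(ltW c0) ?(ltW b0).
  rewrite (_ : _ + B = B' * (2 `^ (- (n%:R / p)) * (8 * c + 2))).
    by rewrite -[leRHS]mulr1 ler_wpM2l.
  rewrite powRD ?pnatr_eq0 ?implybT // powRr1 // /B /B'; field.
  by rewrite pnatr_eq0 -lt0n.
- by move=> u v u0 uv vT; apply: hK.
- move=> a m d x a0 am md dT h1 h2 hx.
  have am' : simplex T (a, m) by split => //=; apply: le_trans dT.
  have md' : simplex T (m, d) by split => //=; apply: le_trans am.
  have x0 : 0 <= x by rewrite -hx cw.1 // (le_trans am).
  have x20 : 0 <= x / 2 by rewrite divr_ge0.
  rewrite (rf_mul hS a0 am md dT).
  apply: le_trans (projective_norm_mul_unital n0 (rf_one hS am') (rf_one hS md')) _.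
  rewrite lerD2l.
  apply: (@le_trans _ _ (\sum_(1 <= j < n)
      c ^+ 2 * b ^+ n * (x / 2) `^ (n%:R / p) * (j%:R ^- 2 * (n - j)%N%:R ^- 2))).
    rewrite big_nat_cond [leRHS]big_nat_cond; apply: ler_sum => j /andP[/andP[j0 jn] _].
    have nj0 : (0 < n - j)%N by rewrite subn_gt0.
    have njn : (n - j < n)%N by rewrite ltn_subrL j0.
    have half i u v : (0 < i)%N -> (i < n)%N -> simplex T (u, v) -> w u v <= x / 2 ->
        `|[S u v i]| <= c / i%:R ^+ 2 * b ^+ i * (x / 2) `^ (i%:R / p).
      move=> i0 lt_in uv hwx; apply: le_trans (IH i lt_in _ _ i0 _ uv) _.
        by apply: leq_trans nM; exact: ltnW.
      rewrite ler_wpM2l //.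
        by rewrite !mulr_ge0 ?invr_ge0 ?exprn_ge0 ?(ltW c0) ?(ltW b0).
      apply: ge0_ler_powR => //; rewrite ?nnegrE ?divr_ge0 ?(ltW p0) //.
      by case: uv => *; exact: cw.1.
    have := ler_pM (projective_norm_ge0 _) (projective_norm_ge0 _)
      (half j a m j0 jn am' h1) (half (n - j)%N m d nj0 njn md' h2).
    move/le_trans; apply; rewrite mulrACA -powRD; last first.
      rewrite -mulrDl -natrD subnKC ?(ltnW jn) //.
      by rewrite mulf_eq0 invr_eq0 (gt_eqF p0) orbF pnatr_eq0 (gtn_eqF n0).
    rewrite -mulrDl -natrD subnKC ?(ltnW jn) // mulrACA -exprD subnKC ?(ltnW jn) //.
    rewrite le_eqVlt; apply/orP; left; apply/eqP.
    by rewrite -[c / _ * _]mulrACA expr2; ring.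
  rewrite -mulr_sumr.
  have A0 : 0 <= c ^+ 2 * b ^+ n * (x / 2) `^ (n%:R / p).
    by rewrite !mulr_ge0 ?exprn_ge0 ?powR_ge0 ?(ltW c0) ?(ltW b0).
  apply: le_trans (ler_wpM2l A0 (sum_inv_sq_convolution_le n0)) _.
  rewrite powR_half // /B le_eqVlt; apply/orP; left; apply/eqP; ring.
Qed.

Lemma rough_family_infinite_radius T p S : 0 < p -> 0 <= T -> rough_family T p S ->
  infinite_radius (S 0 T).
Proof.
move=> p0 T0 hS; apply/infinite_radiusP => r r0.
set N := Num.truncn p.
have pN : p < N.+1%:R by rewrite -truncn_lt_nat // ltW.
pose F := level_sum S p N.
have F0 s t : 0 <= F s t by exact: level_sum_ge0.
have [C FC] := level_sum_bounded N p0 T0 hS.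
have Fd s : 0 <= s -> s <= T -> F s s = 0 by move=> *; exact: (@level_sum_diag T).
have Flsc : endpoint_lsc T F by exact: level_sum_lsc.
have cF := pvar_control F0 FC.
have hF := pvar_halving F0 FC Flsc.
(* Equality in the condition on [c] of [level_decay]; it is positive because N + 1 > p. *)
pose c : R := (2 `^ (N.+1%:R / p) - 2) / 8.
have c0 : 0 < c.
  rewrite divr_gt0 // subr_gt0 -[ltLHS]powRr1 //.
  rewrite -[N.+1%:R / p](subrK 1) powRD ?pnatr_eq0 ?implybT // ltr_pMl ?powR_gt0 //.
  rewrite -[ltLHS](congr1 (@^~ (N.+1%:R / p - 1)) (@powR1 R)).
  by apply: gt0_ltr_powR; rewrite ?nnegrE // ?subr_gt0 ?ltr_pdivlMr ?mul1r //; lra.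
pose b : R := 1 + N.+1%:R ^+ 2 / c.
have b1 : 1 <= b by rewrite lerDl divr_ge0 ?exprn_ge0 // ltW.
have b0 : 0 < b by apply: lt_le_trans b1.
have r1 : 0 < r + 1 by rewrite ltr_wpDl.
(* Chosen so that b * (2 * w0)^(1/p) = 1 / (2 (r + 1)): on intervals of control at most [2 * w0] the
   ratio of the decay, multiplied by r, is at most 1/2. *)
pose w0 : R := (2 * b * (r + 1))^-1 `^ p / 2.
have q0 : 0 < (2 * b * (r + 1))^-1 by rewrite invr_gt0 !mulr_gt0.
have w00 : 0 < w0 by rewrite divr_gt0 // powR_gt0.
have w0p : (2 * w0) `^ p^-1 = (2 * b * (r + 1))^-1.
  by rewrite /w0 mulrCA divff // mulr1 -powRrM divff ?gt_eqF // powRr1 // ltW.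
have small s t : simplex T (s, t) -> pvar F s t <= w0 -> norm_summable r (S s t).
  (* The 1 in [1 + c] covers degree 0, and [c] bounds c / n^2 in the other degrees. *)
  move=> st hst; apply: (@norm_summable_geometric _ _ _ r _ (1 + c) (b * (2 * w0) `^ p^-1)).
  - by rewrite addr_ge0 // ltW.
  - by rewrite mulr_ge0 ?powR_ge0 // ltW.
  - by [].
  - rewrite w0p -mulrA -[leRHS]mul1r [b * _]mulrC !invfM -!mulrA.
    rewrite [X in 2^-1 * X](_ : _ = r / (r + 1)); last by field; rewrite !gt_eqF.
    by rewrite mulrC ler_wpM2r // ler_pdivrMr // mul1r lerDl.
  move=> n; have [->|n0] := posnP n.
    by rewrite (rf_one hS st) projective_norm_tone0 expr0 mulr1 lerDl ltW.
  have [D hD] := level_sum_bounded n p0 T0 hS.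
  (* So small that the added variation of levels up to n stays below [w0], hence
     [pvar G s t <= 2 * w0]. The dependence of [h] on n enters only the a priori constant. *)
  pose h : R := w0 / (`|D| + 1).
  have D1 : 0 < `|D| + 1 by rewrite ltr_wpDl.
  have h0 : 0 < h by rewrite divr_gt0.
  pose G a d := F a d + h * level_sum S p n a d.
  have G0 a d : 0 <= G a d by rewrite addr_ge0 // mulr_ge0 ?level_sum_ge0 // ltW.
  have GC q : itv_partition 0 T q -> psum G 0 q <= C + h * D.
    by move=> hq; rewrite psumD psumZ lerD ?FC // ler_wpM2l ?hD // ltW.
  have Gd a : 0 <= a -> a <= T -> G a a = 0.
    by move=> a0 aT; rewrite /G Fd // (@level_sum_diag T) // mulr0 addr0.
  have Glsc : endpoint_lsc T G.
    by apply: endpoint_lscD => //; apply: endpoint_lscZ => //; exact: level_sum_lsc.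
  have cG := pvar_control G0 GC.
  have hG := pvar_halving G0 GC Glsc.
  have le_G a d : simplex T (a, d) -> G a d <= pvar G a d by exact: (pvar_ge_diag G0 GC Gd).
  have Gst : pvar G s t <= 2 * w0.
    case: st => /= s0 st tT; apply: pvar_le => // q hq; rewrite psumD psumZ.
    have h1 := pvar_ge F0 FC s0 tT hq.
    have h2 := psum_le_bound (level_sum_ge0 S p n) hD s0 tT hq.
    have h3 : h * psum (level_sum S p n) s q <= w0.
      rewrite /h mulrAC ler_pdivrMr // ler_wpM2l ?(ltW w00) //.
      by apply: le_trans h2 _; apply: le_trans (ler_norm D) _; rewrite lerDl.
    by move: h1 h3 hst; lra.
  have G_ge0 a d : simplex T (a, d) -> 0 <= pvar G a d by case=> *; exact: cG.1.
  have mono i : 0 <= i%:R / p by rewrite divr_ge0 // ltW.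
  have := @level_decay T p S (pvar G) n c b p0 hS cG hG c0 b1 _ _ _ _ n s t n0 (leqnn n) st.
  move=> H; apply: le_trans (H _ _ _ _) _.
  - by rewrite /c; lra.
  - by rewrite /b mulrDr mulr1 mulrCA divff ?gt_eqF // mulr1 lerDr ltW.
  - move=> i u v i0 iN uv; apply: le_trans (level_sum_ge _ _ _ p0 i0 iN) _.
    apply: ge0_ler_powR; rewrite ?nnegrE ?level_sum_ge0 ?G_ge0 ?mono //.
    by apply: le_trans (le_G _ _ uv); rewrite lerDl mulr_ge0 ?level_sum_ge0 // ltW.
  - move=> i i0 lt_in; exists (h^-1 `^ (i%:R / p)) => u v uv.
    rewrite -powRM ?invr_ge0 ?(ltW h0) ?G_ge0 //.
    apply: le_trans (level_sum_ge _ _ _ p0 i0 lt_in) _.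
    apply: ge0_ler_powR; rewrite ?mono ?nnegrE ?level_sum_ge0 ?mulr_ge0 ?invr_ge0 ?(ltW h0) ?G_ge0 //.
    rewrite ler_pdivlMl //.
    by apply: le_trans (le_G _ _ uv); rewrite lerDr.
  - rewrite -mulrA; apply: ler_pM.
    + by rewrite divr_ge0 ?exprn_ge0 // ltW.
    + by rewrite mulr_ge0 ?exprn_ge0 ?powR_ge0 // ltW.
    + apply: (@le_trans _ _ c); last by rewrite lerDr.
      by rewrite ler_pdivrMr ?exprn_gt0 ?ltr0n // ler_peMr ?(ltW c0) // exprn_ege1 // ler1n.
    + rewrite exprMn ler_wpM2l ?exprn_ge0 ?(ltW b0) //.
      rewrite -powR_mulrn ?powR_ge0 // -powRrM [p^-1 * _]mulrC.
      by apply: ge0_ler_powR; rewrite ?nnegrE ?G_ge0 ?mono // mulr_ge0 // ltW.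
(* After j halvings every piece has control at most [w0]; summability at radius r passes to
   products. *)
have doubling j s t : simplex T (s, t) -> pvar F s t <= w0 * 2 ^+ j -> norm_summable r (S s t).
  elim: j s t => [|j IH] s t st hst; first by apply: small; rewrite // expr0 mulr1 in hst.
  have [s0 st' tT] := st; have [m [sm mt h1 h2]] := hF s t s0 st' tT.
  have hh : pvar F s t / 2 <= w0 * 2 ^+ j by rewrite exprS mulrCA in hst; lra.
  rewrite (rf_mul hS s0 sm mt tT); apply: norm_summable_mul => //.
    apply: IH; last exact: le_trans hh.
    by split => //=; apply: le_trans tT.
  apply: IH; last exact: le_trans hh.
  by split => //=; apply: le_trans sm.
pose j := Num.bound (pvar F 0 T / w0).
apply: (doubling j); first by split.
rewrite mulrC -ler_pdivrMr //; apply: le_trans (ltW (archi_boundP _)) _.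
  by rewrite divr_ge0 ?cF.1 // ltW.
by rewrite -natrX ler_nat ltnW // ltn_expl.
Qed.

End RoughEstimates.

(** * Signatures *)

Section Signatures.
Context {R : realType} {k : scalar_kind} {V : finNormedModType (scalars R k)}.
Implicit Types (S : R -> R -> tseries V) (T p : R) (X Y : path_data V).

(* No existence theorem is needed: when there is no extension, [lyons_extension] is the
   constant family [tone V], which is itself multiplicative of finite variation. *)
Lemma rough_family_lyons X : 0 < exponent X -> 0 <= horizon X ->
  rough_family (horizon X) (exponent X) (lyons_extension X).
Proof.
move=> p0 T0; rewrite /lyons_extension.
case: xgetP => [S _ [_ hS]|_]; first exact: mf_rough_family.
exact: rough_family_one.
Qed.

Lemma lyons_extension_unique X S : 0 < exponent X -> 0 <= horizon X ->
  is_lyons_extension X S ->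
  forall s t, simplex (horizon X) (s, t) -> lyons_extension X s t = S s t.
Proof.
move=> p0 T0 hS; have : is_lyons_extension X (lyons_extension X).
  by rewrite /lyons_extension; case: xgetP => [S' _ //|/(_ S)].
move=> hE; apply: (rough_family_unique p0 T0); [exact: mf_rough_family hE.2|exact: mf_rough_family hS.2|].
by move=> n s t nX st; rewrite hE.1 // hS.1.
Qed.

Lemma concat_exponent_gt0 Y X : 0 < exponent Y -> 0 < exponent (concat Y X).
Proof. by move=> h; rewrite lt_max h. Qed.

Lemma concat_horizon_ge0 Y X : 0 <= horizon Y -> 0 <= horizon X -> 0 <= horizon (concat Y X).
Proof. exact: addr_ge0. Qed.

(** [concat] is built from the chosen families [lyons_extension], so gluing these always gives an
    extension of it; uniqueness identifies this with the chosen one. *)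
Lemma signature_concat Y X : 0 < exponent Y -> 0 < exponent X ->
  0 <= horizon Y -> 0 <= horizon X ->
  signature (concat Y X) = signature Y * signature X.
Proof.
move=> pY pX TY TX; have pC := concat_exponent_gt0 X pY.
have TC := concat_horizon_ge0 TY TX.
have hY : rough_family (horizon Y) (exponent (concat Y X)) (lyons_extension Y).
  by apply: (rough_family_exponent pY); [rewrite le_max lexx|exact: rough_family_lyons].
have hX : rough_family (horizon X) (exponent (concat Y X)) (lyons_extension X).
  by apply: (rough_family_exponent pX); [rewrite le_max lexx orbT|exact: rough_family_lyons].
pose G := glue (horizon Y) (lyons_extension Y) (lyons_extension X).
have hG : is_lyons_extension (concat Y X) G.
  split=> [n s t nC|N]; last exact/rough_family_mf/rough_family_glue.
  move=> [/= s0 st tT]; rewrite /ttrunc nC; congr (_ n).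
  have [tY|Yt] := leP t (horizon Y); first exact: glue_lel hX st tY.
  have [sY|Ys] := leP s (horizon Y); last exact: glue_ger hY (ltW Ys) st.
  rewrite /G /glue min_l // min_r ?(ltW Yt) // max_l ?subr_le0 // max_r //.
  by rewrite subr_ge0 ltW.
rewrite /signature (lyons_extension_unique pC TC hG) //.
rewrite /G /glue /= min_l // min_r ?lerDl // max_l ?subr_le0 // addrC addKr.
by rewrite max_r.
Qed.

(** Time reversal turns extensions of [Y] into extensions of [reversal Y], and conversely. Hence
    either both exist and uniqueness applies, or both signatures have the default value 1, which is
    its own inverse. *)
Lemma signature_reversal Y : rough_path Y -> signature (reversal Y) = tinv (signature Y).
Proof.
move=> hY; have TY := rp_horizon hY.
have pY : 0 < exponent Y by apply: lt_le_trans (rp_exponent hY).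
have [[S hS]|noS] := pselect (exists S, is_lyons_extension Y S).
  have rS := mf_rough_family pY TY hS.2.
  have hR : is_lyons_extension (reversal Y) (time_reversal (horizon Y) S).
    split=> [n s t nY st|N]; last exact/rough_family_mf/rough_family_reversal.
    rewrite /= /ttrunc nY; apply: tinv_ext => m mn; apply: hS.1.
      exact: leq_trans nY.
    exact: reversal_simplex.
  rewrite /signature (lyons_extension_unique _ _ hR) // (lyons_extension_unique _ _ hS) //.
  by rewrite /time_reversal /= subrr subr0.
have noR : ~ exists S, is_lyons_extension (reversal Y) S.
  move=> [S hS]; apply: noS; exists (time_reversal (horizon Y) S).
  have rS : rough_family (horizon Y) (exponent Y) S by exact: mf_rough_family hS.2.
  split=> [n s t nY st|N]; last exact/rough_family_mf/rough_family_reversal.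
  have y0 : increment Y s t 0 = tone V 0 by exact: (mf_one (rp_functional hY)).
  rewrite -[increment Y s t](tinvK y0); apply: tinv_ext => m mn.
  rewrite hS.1; last 2 first.
  - exact: leq_trans nY.
  - exact: reversal_simplex.
  by rewrite /= /ttrunc (leq_trans mn nY) !subKr.
have trivial Z : (~ exists S, is_lyons_extension Z S) -> signature Z = 1.
  by move=> noZ; rewrite /signature /lyons_extension; case: xgetP => // S _ hS; case: noZ; exists S.
by rewrite !trivial // tinv1.
Qed.

Lemma infinite_radius_signature X : 0 < exponent X -> 0 <= horizon X ->
  infinite_radius (signature X).
Proof. by move=> p0 T0; exact: rough_family_infinite_radius (rough_family_lyons p0 T0). Qed.

Lemma signature_degree0 X : 0 < exponent X -> 0 <= horizon X -> signature X 0 = tone V 0.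
Proof. by move=> p0 T0; apply: (rf_one (rough_family_lyons p0 T0)). Qed.

End Signatures.

Theorem proposition2p6 (R : realType) (k : scalar_kind)
    (V : finNormedModType (scalars R k)) (X Y : path_data V)
    (hX : rough_path X) (hY : rough_path Y) :
  infinite_radius (tlog (signature X)) <->
  infinite_radius
    (tlog (signature (concat (concat Y X) (reversal Y)))).
Proof.
have TX := rp_horizon hX; have TY := rp_horizon hY.
have pX : 0 < exponent X by apply: lt_le_trans (rp_exponent hX).
have pY : 0 < exponent Y by apply: lt_le_trans (rp_exponent hY).
have pR : 0 < exponent (reversal Y) by [].
have TR : 0 <= horizon (reversal Y) by [].
have pC := concat_exponent_gt0 X pY; have TC := concat_horizon_ge0 TY TX.
have sigE : signature (concat (concat Y X) (reversal Y)) =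
    signature Y * signature X * tinv (signature Y).
  transitivity (signature (concat Y X) * signature (reversal Y)); first exact: signature_concat.
  congr (_ * _); [exact: signature_concat|exact: signature_reversal].
have rg := infinite_radius_signature pY TY.
have rV : infinite_radius (tinv (signature Y)).
  have <- : signature (reversal Y) = tinv (signature Y) by exact: signature_reversal.
  exact: infinite_radius_signature pR TR.
rewrite sigE tlog_conj; [|exact: signature_degree0|exact: signature_degree0].
exact: infinite_radius_conj (signature_degree0 pY TY) rg rV.
Qed.
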